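(* The function $\zeta(0,s)$ is analytic on $\mathbb{C}$ except at $s=2,1$, and has a pole at $s=2$ with residue $1$ and a pole at $s=1$ with residue $2\zeta(0)$. The function $\zeta(-1,s+1)$ is analytic except at $s=2,1$, and has a pole at $s=2$ with residue $1/2$ and a pole at $s=1$ with residue $\zeta(0)$. For an integer $n\ge2$, the function $\zeta(-n,s+n)$ is analytic except at $s=2,1,0,-2,-4,\dots,-2\lfloor n/2\rfloor+2$, and has poles: at $s=2$ with residue $\frac{1}{n+1}$; at $s=1$ with residue $\zeta(0)=-\frac12$; and at $s=-2k$ with residue $\binom{2k-n}{2k+1}\zeta(-2k-1)$, for $k=0,1,\dots,\lfloor n/2\rfloor-1$.
   Context: $\zeta(\cdot)$ of one variable is the Riemann zeta function. For an integer $n\ge 0$, $\zeta(-n,s+n)$ denotes the Euler–Zagier double zeta function $\zeta(s_1,s_2)=\sum_{1\le n_1<n_2} n_1^{-s_1}n_2^{-s_2}$ evaluated at $(s_1,s_2)=(-n,s+n)$; i.e. it is the meromorphic continuation to all $s\in\mathbb{C}$ of the series $\sum_{m,j\ge1} m^{n}(m+j)^{-s-n}$, which converges absolutely for $\Re(s)>2$. For an integer $a$ and non-negative integer $b$, $\binom{a}{b}=a(a-1)\cdots(a-b+1)/b!$. *)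

(* Defs.v *)
From Stdlib Require Import Reals ZArith Factorial.
From Coquelicot Require Export Coquelicot.

Open Scope R_scope.

(* x^s := exp(s * ln x) for a real x > 0 and complex s. *)
Definition cpow (x : R) (s : C) : C :=
  (exp (Re s * ln x) * cos (Im s * ln x), exp (Re s * ln x) * sin (Im s * ln x)).

(* complex differentiability of f at z (f holomorphic at z when this holds on a
   neighbourhood; we only use it on open sets) *)
Definition holo_at (f : C -> C) (z : C) : Prop :=
  @ex_derive C_AbsRing C_NormedModule f z.

Definition riemann_zeta (Z : C -> C) : Prop :=
  (forall s : C, s <> RtoC 1 -> holo_at Z s) /\
  (forall s : C, 1 < Re s ->
     @is_series C_AbsRing C_NormedModule
       (fun k : nat => cpow (INR (k + 1)) (Copp s)) (Z s)).

(* term m^n (m+j)^{-s-n}, with m = m'+1, j = j'+1 *)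
Definition dz_term (n : nat) (s : C) (m' j' : nat) : C :=
  Cmult (RtoC (INR (m' + 1) ^ n))
        (cpow (INR (m' + j' + 2)) (Copp (Cplus s (RtoC (INR n))))).

(* F agrees with the (absolutely convergent) series
   sum_{m,j>=1} m^n (m+j)^{-s-n} = zeta(-n, s+n) on Re s > 2
   (written as an iterated series). *)
Definition dz_rep (n : nat) (F : C -> C) : Prop :=
  forall s : C, 2 < Re s ->
    exists inner : nat -> C,
      (forall m : nat, @is_series C_AbsRing C_NormedModule (dz_term n s m) (inner m)) /\
      @is_series C_AbsRing C_NormedModule inner (F s).

Definition pole_res (F : C -> C) (a r : C) : Prop :=
  r <> RtoC 0 /\
  exists delta : R, 0 < delta /\
    exists g : C -> C,
      (forall z : C, Cmod (Cminus z a) < delta -> holo_at g z) /\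
      (forall z : C, 0 < Cmod (Cminus z a) < delta ->
         F z = Cplus (g z) (Cdiv r (Cminus z a))).

Fixpoint falling (a : Z) (b : nat) : R :=
  match b with
  | O => 1
  | S b' => falling a b' * (IZR a - INR b')
  end.
Definition gbinom (a : Z) (b : nat) : R := falling a b / INR (fact b).

(* Main.v *)
Require Import Defs.
From Stdlib Require Import Reals ZArith Lra Lia.
From Coquelicot Require Import Coquelicot.
Open Scope R_scope.

(** The inner sums are power sums, so by Faulhaber's formula zeta(-n, s+n) is the combination
    [sum_j n! b_j / (n+1-j)! * zeta (s-1+j)], with [b_j = B_j / j!], of shifted Riemann zeta
    functions, and its poles are the shifted poles of zeta whose coefficient does not vanish.
    What remains is the behaviour of an arbitrary holomorphic continuation of zeta near 1 and its
    values at 0, -1, -3, ...  These are read off the Euler-Maclaurin expansion, which agrees with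
    zeta on the half plane Re s > 1; the agreement spreads to punctured discs around 1 by a
    uniqueness theorem.

    For uniqueness, put [s = 1 + exp w]: the difference becomes holomorphic in a left half plane
    and zero on its real axis.  Goursat's theorem for this function times [exp (-lam (w - w0)^2)],
    on a rectangle with one side on the real axis and [w0] in the middle of the opposite side,
    leaves only exponentially small contributions from the vertical sides, while the integral
    through [w0] concentrates at [w0]; hence the function vanishes at [w0]. *)

(** * Complex differentiability *)

Lemma Cmod_le_Rabs_sum (z : C) : Cmod z <= Rabs (Re z) + Rabs (Im z).
Proof.
  replace z with (Re z + Ci * Im z)%C at 1
    by (apply injective_projections; unfold Re, Im; simpl; ring).
  rewrite <- !Cmod_R, <- (Rmult_1_l (Cmod (Im z))), <- Cmod_Ci, <- Cmod_mult.
  apply Cmod_triangle.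
Qed.

Lemma Cmod_minus_le (x y : C) : Cmod (x - y) <= Cmod x + Cmod y.
Proof. rewrite <- (Cmod_opp y); apply Cmod_triangle. Qed.

Lemma Cmod_triangle_rev (x y : C) : Cmod x - Cmod y <= Cmod (x + y).
Proof.
  pose proof (Cmod_minus_le (x + y) y) as Htri; replace (x + y - y)%C with x in Htri by ring; lra.
Qed.

Lemma Cmod_plus4_le (z1 z2 z3 z4 : C) (M : R) :
  Cmod z1 <= M -> Cmod z2 <= M -> Cmod z3 <= M -> Cmod z4 <= M ->
  Cmod (z1 + z2 + z3 + z4) <= 4 * M.
Proof.
  intros; pose proof (Cmod_triangle (z1 + z2 + z3) z4); pose proof (Cmod_triangle (z1 + z2) z3).
  pose proof (Cmod_triangle z1 z2); lra.
Qed.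

(* Coquelicot differentiates products and compositions in the normed module underlying the ring
   [C_AbsRing], which is not convertible to the [C_NormedModule] used by [holo_at]. *)
Lemma holo_at_iff_ex_derive (f : C -> C) (z : C) :
  holo_at f z <-> @ex_derive C_AbsRing (AbsRing_NormedModule C_AbsRing) f z.
Proof.
  split; intros [l [_ H]]; exists l; (split; [|exact H]).
  - apply (is_linear_scal_l (K := C_AbsRing)).
  - apply (is_linear_scal_l (K := C_AbsRing) (V := C_NormedModule)).
Qed.

Lemma holo_at_iff (f : C -> C) (z : C) :
  holo_at f z <-> exists l : C, forall eps : R, 0 < eps -> exists d : R, 0 < d /\
    forall y : C, Cmod (y - z) < d -> Cmod (f y - f z - l * (y - z)) <= eps * Cmod (y - z).
Proof.
  rewrite holo_at_iff_ex_derive; split.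
  - intros [l [_ H]]; exists l; intros eps Heps.
    destruct (H z (fun P HP => HP) (mkposreal eps Heps)) as [d Hd].
    exists d; split; [apply cond_pos|]; intros y Hy.
    rewrite (Cmult_comm l); exact (Hd y Hy).
  - intros [l H]; exists l; split; [apply (is_linear_scal_l (K := C_AbsRing))|].
    intros x Hx eps.
    apply (is_filter_lim_locally_unique (V := AbsRing_NormedModule C_AbsRing)) in Hx; subst x.
    destruct (H eps (cond_pos eps)) as [d [Hd Hdiff]].
    exists (mkposreal d Hd); intros y Hy.
    specialize (Hdiff y Hy); rewrite (Cmult_comm l) in Hdiff; exact Hdiff.
Qed.

Lemma holo_at_ext (f g : C -> C) (z : C) : (forall y, f y = g y) -> holo_at f z -> holo_at g z.
Proof. apply (ex_derive_ext (K := C_AbsRing) (V := C_NormedModule)). Qed.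

Lemma holo_at_const (c z : C) : holo_at (fun _ => c) z.
Proof. apply (ex_derive_const (K := C_AbsRing) (V := C_NormedModule)). Qed.

Lemma holo_at_id (z : C) : holo_at (fun y => y) z.
Proof. apply holo_at_iff_ex_derive, ex_derive_id. Qed.

Lemma holo_at_plus (f g : C -> C) (z : C) :
  holo_at f z -> holo_at g z -> holo_at (fun y => f y + g y)%C z.
Proof. apply (ex_derive_plus (K := C_AbsRing) (V := C_NormedModule)). Qed.

Lemma holo_at_opp (f : C -> C) (z : C) : holo_at f z -> holo_at (fun y => - f y)%C z.
Proof. apply (ex_derive_opp (K := C_AbsRing) (V := C_NormedModule)). Qed.

Lemma holo_at_minus (f g : C -> C) (z : C) :
  holo_at f z -> holo_at g z -> holo_at (fun y => f y - g y)%C z.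
Proof. apply (ex_derive_minus (K := C_AbsRing) (V := C_NormedModule)). Qed.

Lemma holo_at_mult (f g : C -> C) (z : C) :
  holo_at f z -> holo_at g z -> holo_at (fun y => f y * g y)%C z.
Proof.
  rewrite !holo_at_iff_ex_derive; intros [a Ha] [b Hb].
  eexists; apply (is_derive_mult (K := C_AbsRing)); [exact Ha|exact Hb|apply Cmult_comm].
Qed.

Lemma holo_at_comp (f g : C -> C) (z : C) :
  holo_at f (g z) -> holo_at g z -> holo_at (fun y => f (g y)) z.
Proof.
  rewrite (holo_at_iff_ex_derive g); apply (ex_derive_comp (K := C_AbsRing) (V := C_NormedModule)).
Qed.

Create HintDb holo.
#[local] Hint Resolve holo_at_const holo_at_id holo_at_plus holo_at_opp holo_at_minus
  holo_at_mult : holo.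

Lemma holo_at_sum_n (f : nat -> C -> C) (L : nat) (z : C) :
  (forall j, (j <= L)%nat -> holo_at (f j) z) -> holo_at (fun s => sum_n (fun j => f j s) L) z.
Proof.
  induction L as [|L IH]; intros H.
  - apply holo_at_ext with (f 0%nat); [intros y; now rewrite sum_O|now apply H].
  - apply holo_at_ext with (fun s => sum_n (fun j => f j s) L + f (S L) s)%C.
    + intros y; now rewrite sum_Sn.
    + apply holo_at_plus; [apply IH; intros; apply H; lia|now apply H].
Qed.

Lemma holo_at_quadratic_remainder (f : C -> C) (z l : C) (K d : R) : 0 < d ->
  (forall h, Cmod h < d -> Cmod (f (z + h)%C - f z - l * h) <= K * Cmod h ^ 2) ->
  holo_at f z.
Proof.
  intros Hd H; apply holo_at_iff; exists l; intros eps Heps.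
  pose proof (Rabs_pos K) as HK; pose proof (Rle_abs K) as HleK.
  assert (Hquot : 0 < eps / (Rabs K + 1)) by (apply Rdiv_lt_0_compat; lra).
  exists (Rmin d (eps / (Rabs K + 1))); split; [now apply Rmin_glb_lt|].
  intros y Hy; apply Rmin_Rgt in Hy; destruct Hy as [Hyd Hyeps].
  specialize (H (y - z)%C Hyd); replace (z + (y - z))%C with y in H by ring.
  apply Rle_trans with (1 := H).
  apply Rlt_div_r in Hyeps; [|lra].
  pose proof (Cmod_ge_0 (y - z)); simpl; nra.
Qed.

Lemma holo_at_Cinv (z : C) : z <> 0 -> holo_at Cinv z.
Proof.
  intros Hz; pose proof (proj1 (Cmod_gt_0 z) Hz) as Hpos.
  apply holo_at_quadratic_remainder with (- / (z * z))%C (2 / (Cmod z ^ 3)) (Cmod z / 2); [lra|].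
  intros h Hh; pose proof (Cmod_triangle_rev z h).
  assert (Hzh : (z + h)%C <> 0) by (apply Cmod_gt_0; lra).
  replace (/ (z + h) - / z - - / (z * z) * h)%C with (h * h * / (z * z * (z + h)))%C
    by (field; auto).
  rewrite !Cmod_mult, Cmod_inv, !Cmod_mult by (repeat apply Cmult_neq_0; auto).
  replace (2 / Cmod z ^ 3 * Cmod h ^ 2)
    with (Cmod h * Cmod h * / (Cmod z * Cmod z * (Cmod z / 2))) by (field; lra).
  pose proof (Cmod_ge_0 h).
  apply Rmult_le_compat_l; [nra|].
  apply Rinv_le_contravar; [repeat apply Rmult_lt_0_compat; lra|].
  apply Rmult_le_compat_l; nra.
Qed.

(** * Complex-valued functions of a real variable *)

#[local] Notation ex_CInt := (ex_RInt (V := C_R_NormedModule)).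
#[local] Notation is_CInt := (is_RInt (V := C_R_NormedModule)).
#[local] Notation CInt := (RInt (V := C_R_CompleteNormedModule)).
#[local] Notation Ccontinuous := (continuous (T := R_UniformSpace) (U := C_UniformSpace)).
#[local] Notation is_Cderive := (is_derive (K := R_AbsRing) (V := C_R_NormedModule)).

Lemma norm_C_R (z : C) : norm (K := R_AbsRing) (V := C_R_NormedModule) z = Cmod z.
Proof.
  change (sqrt (Rabs (fst z) ^ 2 + Rabs (snd z) ^ 2) = Cmod z); now rewrite !pow2_abs.
Qed.

Lemma Ccontinuous_pair (f g : R -> R) (x : R) :
  continuous f x -> continuous g x -> Ccontinuous (fun t => (f t, g t)) x.
Proof.
  intros Hf Hg; apply (continuous_comp_2 f g pair); [exact Hf|exact Hg|].
  apply (continuous_ext (fun p => p)); [now intros []|apply continuous_id].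
Qed.

Lemma is_Cderive_pair (f g : R -> R) (x a b : R) :
  is_derive f x a -> is_derive g x b -> is_Cderive (fun t => (f t, g t)) x (a, b).
Proof.
  intros Hf Hg.
  apply (is_derive_ext (V := C_R_NormedModule)
    (fun t => plus (scal (f t) (RtoC 1)) (scal (g t) Ci))).
  { intros t; rewrite !scal_R_Cmult.
    change (f t * 1 + g t * Ci = (f t, g t))%C; apply injective_projections; simpl; ring. }
  replace (a, b) with (plus (scal a (RtoC 1)) (scal b Ci : C_R_NormedModule)).
  2:{ rewrite !scal_R_Cmult; change (a * 1 + b * Ci = (a, b))%C.
      apply injective_projections; simpl; ring. }
  apply (is_derive_plus (V := C_R_NormedModule));
    now apply (is_derive_scal_l (V := C_R_NormedModule)).
Qed.

Lemma holo_at_Ccontinuous (f : C -> C) (p : R -> C) (t : R) :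
  holo_at f (p t) -> Ccontinuous p t -> Ccontinuous (fun t => f (p t)) t.
Proof.
  intros Hf Hp; apply (continuous_comp (V := C_UniformSpace) p f _ Hp).
  apply (ex_derive_continuous (K := C_AbsRing) (V := C_NormedModule)) in Hf.
  intros P HP; apply locally_C; exact (Hf P HP).
Qed.

Lemma Ccontinuous_Rmult (p : R -> R) (f : R -> C) (t : R) :
  continuous p t -> Ccontinuous f t -> Ccontinuous (fun t => RtoC (p t) * f t)%C t.
Proof.
  intros Hp Hf; apply (continuous_ext (fun t => scal (p t) (f t : C_R_NormedModule))).
  { intros u; apply scal_R_Cmult. }
  now apply (continuous_scal (K := R_AbsRing) (V := C_R_NormedModule)).
Qed.

Lemma ex_CInt_Ccontinuous (f : R -> C) (a b : R) : a <= b ->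
  (forall t, a <= t <= b -> Ccontinuous f t) -> ex_CInt f a b.
Proof.
  intros Hab Hf; apply (ex_RInt_continuous (V := C_R_CompleteNormedModule)).
  intros t; rewrite Rmin_left, Rmax_right by exact Hab; apply Hf.
Qed.

Lemma CInt_correct (f : R -> C) (a b : R) : ex_CInt f a b -> is_CInt f a b (CInt f a b).
Proof. apply (RInt_correct (V := C_R_CompleteNormedModule)). Qed.

Lemma is_CInt_unique (f : R -> C) (a b : R) (l : C) : is_CInt f a b l -> CInt f a b = l.
Proof. apply (is_RInt_unique (V := C_R_CompleteNormedModule)). Qed.

Lemma is_CInt_plus (f g : R -> C) (a b : R) (l m : C) :
  is_CInt f a b l -> is_CInt g a b m -> is_CInt (fun t => f t + g t)%C a b (l + m)%C.
Proof. apply (is_RInt_plus (V := C_R_NormedModule)). Qed.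

Lemma is_CInt_minus (f g : R -> C) (a b : R) (l m : C) :
  is_CInt f a b l -> is_CInt g a b m -> is_CInt (fun t => f t - g t)%C a b (l - m)%C.
Proof. apply (is_RInt_minus (V := C_R_NormedModule)). Qed.

Lemma is_CInt_mult_r (f : R -> C) (a b : R) (c l : C) :
  is_CInt f a b l -> is_CInt (fun t => f t * c)%C a b (l * c)%C.
Proof.
  intros H.
  pose proof (is_RInt_fct_extend_fst (U := R_NormedModule) (V := R_NormedModule) _ _ _ _ H) as Hre.
  pose proof (is_RInt_fct_extend_snd (U := R_NormedModule) (V := R_NormedModule) _ _ _ _ H) as Him.
  apply (is_RInt_ext (V := C_R_NormedModule)
    (fun t => (fst c * fst (f t) - snd c * snd (f t), snd c * fst (f t) + fst c * snd (f t)))).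
  { intros t _; apply injective_projections; simpl; ring. }
  replace (l * c)%C with (fst c * fst l - snd c * snd l, snd c * fst l + fst c * snd l)
    by (apply injective_projections; simpl; ring).
  apply (is_RInt_fct_extend_pair (U := R_NormedModule) (V := R_NormedModule)); simpl;
    [apply (is_RInt_minus (V := R_NormedModule))|apply (is_RInt_plus (V := R_NormedModule))];
    now apply (is_RInt_scal (V := R_NormedModule)).
Qed.

Lemma CInt_Chasles (f : R -> C) (a b c : R) :
  ex_CInt f a b -> ex_CInt f b c -> CInt f a c = (CInt f a b + CInt f b c)%C.
Proof. intros Hab Hbc; symmetry; now apply (RInt_Chasles (V := C_R_CompleteNormedModule)). Qed.

Lemma is_CInt_derive (f df : R -> C) (a b : R) : a <= b ->
  (forall t, a <= t <= b -> is_Cderive f t (df t)) ->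
  (forall t, a <= t <= b -> Ccontinuous df t) -> is_CInt df a b (f b - f a)%C.
Proof.
  intros Hab Hf Hdf; apply (is_RInt_derive (V := C_R_CompleteNormedModule));
    intros t; rewrite Rmin_left, Rmax_right by exact Hab; auto.
Qed.

Lemma Cmod_is_CInt_le (f : R -> C) (a b : R) (l : C) (M : R) : a <= b -> is_CInt f a b l ->
  (forall t, a <= t <= b -> Cmod (f t) <= M) -> Cmod l <= (b - a) * M.
Proof.
  intros Hab Hf HM; rewrite <- norm_C_R.
  apply (norm_RInt_le_const (V := C_R_NormedModule) f); [exact Hab| |exact Hf].
  intros t Ht; rewrite norm_C_R; now apply HM.
Qed.

Lemma Cmod_increment_le (f df : R -> C) (a b M : R) : a <= b ->
  (forall t, a <= t <= b -> is_Cderive f t (df t)) ->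
  (forall t, a <= t <= b -> Ccontinuous df t) ->
  (forall t, a <= t <= b -> Cmod (df t) <= M) -> Cmod (f b - f a) <= (b - a) * M.
Proof.
  intros Hab Hf Hdf; apply Cmod_is_CInt_le with (f := df); [exact Hab|].
  now apply is_CInt_derive.
Qed.

(** * Complex exponentials and powers *)

Definition cexp (z : C) : C := (exp (Re z) * cos (Im z), exp (Re z) * sin (Im z)).

Lemma cexp_plus (a b : C) : cexp (a + b) = (cexp a * cexp b)%C.
Proof.
  unfold cexp; rewrite re_plus, im_plus, exp_plus, cos_plus, sin_plus.
  apply injective_projections; simpl; ring.
Qed.

Lemma cexp_RtoC (x : R) : cexp (RtoC x) = RtoC (exp x).
Proof. unfold cexp; rewrite re_RtoC, im_RtoC, cos_0, sin_0; unfold RtoC; f_equal; ring. Qed.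

Lemma Cmod_cexp (z : C) : Cmod (cexp z) = exp (Re z).
Proof.
  unfold cexp, Cmod; simpl fst; simpl snd.
  replace ((exp (Re z) * cos (Im z)) ^ 2 + (exp (Re z) * sin (Im z)) ^ 2)
    with (exp (Re z) ^ 2 * (Rsqr (sin (Im z)) + Rsqr (cos (Im z)))) by (unfold Rsqr; ring).
  rewrite sin2_cos2, Rmult_1_r; apply sqrt_pow2, Rlt_le, exp_pos.
Qed.

Lemma exp_le (x y : R) : x <= y -> exp x <= exp y.
Proof. intros [H| ->]; [left; now apply exp_increasing|apply Rle_refl]. Qed.

Lemma is_Cderive_cexp_line (h : C) (t : R) :
  is_Cderive (fun t => cexp (h * RtoC t)) t (h * cexp (h * RtoC t))%C.
Proof.
  apply (is_derive_ext (V := C_R_NormedModule)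
    (fun t => (exp (Re h * t) * cos (Im h * t), exp (Re h * t) * sin (Im h * t)))).
  { intros u; unfold cexp; now rewrite re_scal_r, im_scal_r. }
  unfold cexp; rewrite re_scal_r, im_scal_r.
  apply is_Cderive_pair; auto_derive; trivial; unfold Re, Im; simpl; ring.
Qed.

Lemma Ccontinuous_cexp_line (h : C) (t : R) : Ccontinuous (fun t => cexp (h * RtoC t)) t.
Proof.
  apply (ex_derive_continuous (V := C_R_NormedModule)); eexists; apply is_Cderive_cexp_line.
Qed.

Lemma Cmod_cexp_line_le (h : C) (t : R) : 0 <= t <= 1 -> Cmod (cexp (h * RtoC t)) <= exp (Cmod h).
Proof.
  intros Ht; rewrite Cmod_cexp, re_scal_r; apply exp_le.
  pose proof (re_le_Cmod h); pose proof (Rle_abs (Re h)); pose proof (Cmod_ge_0 h); nra.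
Qed.

Lemma Cmod_cexp_line_minus_1_le (h : C) (t : R) : 0 <= t <= 1 ->
  Cmod (cexp (h * RtoC t) - 1) <= Cmod h * exp (Cmod h).
Proof.
  intros Ht.
  replace (RtoC 1) with (cexp (h * RtoC 0))
    by (replace (h * 0)%C with (RtoC 0) by ring; rewrite cexp_RtoC, exp_0; reflexivity).
  apply Rle_trans with ((t - 0) * (Cmod h * exp (Cmod h))).
  - apply (Cmod_increment_le (fun t => cexp (h * RtoC t)) (fun t => h * cexp (h * RtoC t))%C);
      [lra|intros; apply is_Cderive_cexp_line| |].
    + intros u _; apply (holo_at_Ccontinuous (fun z => h * z)%C); [auto with holo|].
      apply Ccontinuous_cexp_line.
    + intros u Hu; rewrite Cmod_mult; apply Rmult_le_compat_l; [apply Cmod_ge_0|].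
      apply Cmod_cexp_line_le; lra.
  - pose proof (exp_pos (Cmod h)); pose proof (Cmod_ge_0 h).
    assert (0 <= Cmod h * exp (Cmod h)) by nra; nra.
Qed.

Lemma cexp_remainder (h : C) : Cmod (cexp h - 1 - h) <= exp (Cmod h) * Cmod h ^ 2.
Proof.
  replace (cexp h - 1 - h)%C
    with (cexp (h * RtoC 1) - h * RtoC 1 - (cexp (h * RtoC 0) - h * RtoC 0))%C.
  2:{ replace (h * 0)%C with (RtoC 0) by ring; rewrite cexp_RtoC, exp_0.
      replace (h * 1)%C with h by ring; ring. }
  replace (exp (Cmod h) * Cmod h ^ 2) with ((1 - 0) * (Cmod h * (Cmod h * exp (Cmod h)))) by ring.
  apply (Cmod_increment_le (fun t => cexp (h * RtoC t) - h * RtoC t)%C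
    (fun t => h * (cexp (h * RtoC t) - 1))%C); [lra| | |].
  - intros t _; apply (is_derive_ext (V := C_R_NormedModule)
      (fun t => minus (cexp (h * RtoC t)) (scal t h : C_R_NormedModule))).
    { intros u; rewrite scal_R_Cmult.
      change (cexp (h * u) - u * h = cexp (h * u) - h * u)%C; ring. }
    replace (h * (cexp (h * t) - 1))%C
      with (minus (h * cexp (h * RtoC t))%C (scal 1 h : C_R_NormedModule)).
    2:{ rewrite scal_R_Cmult; change (h * cexp (h * t) - 1 * h = h * (cexp (h * t) - 1))%C; ring. }
    apply (is_derive_minus (V := C_R_NormedModule)); [apply is_Cderive_cexp_line|].
    apply (is_derive_scal_l (V := C_R_NormedModule)), (is_derive_id (K := R_AbsRing)).
  - intros t _; apply (holo_at_Ccontinuous (fun z => h * (z - 1))%C); [auto with holo|].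
    apply Ccontinuous_cexp_line.
  - intros t Ht; rewrite Cmod_mult; apply Rmult_le_compat_l; [apply Cmod_ge_0|].
    now apply Cmod_cexp_line_minus_1_le.
Qed.

Lemma holo_at_cexp (z : C) : holo_at cexp z.
Proof.
  apply holo_at_quadratic_remainder with (cexp z) (Cmod (cexp z) * exp 1) 1; [lra|].
  intros h Hh; rewrite cexp_plus.
  replace (cexp z * cexp h - cexp z - cexp z * h)%C with (cexp z * (cexp h - 1 - h))%C by ring.
  rewrite Cmod_mult, Rmult_assoc; apply Rmult_le_compat_l; [apply Cmod_ge_0|].
  apply Rle_trans with (1 := cexp_remainder h).
  apply Rmult_le_compat_r; [apply pow2_ge_0|]; apply exp_le; lra.
Qed.

Lemma cpow_cexp (x : R) (s : C) : cpow x s = cexp (s * ln x).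
Proof. unfold cpow, cexp; now rewrite re_scal_r, im_scal_r. Qed.

Lemma cpow_plus (x : R) (z w : C) : cpow x (z + w) = (cpow x z * cpow x w)%C.
Proof. rewrite !cpow_cexp, <- cexp_plus; f_equal; ring. Qed.

Lemma cpow_RtoC (x y : R) : cpow x (RtoC y) = RtoC (exp (y * ln x)).
Proof. rewrite cpow_cexp, <- RtoC_mult; apply cexp_RtoC. Qed.

Lemma Cmod_cpow (x : R) (z : C) : Cmod (cpow x z) = exp (Re z * ln x).
Proof. now rewrite cpow_cexp, Cmod_cexp, re_scal_r. Qed.

Lemma cpow_1_l (z : C) : cpow 1 z = 1.
Proof.
  rewrite cpow_cexp, ln_1; replace (z * 0)%C with (RtoC 0) by ring.
  rewrite cexp_RtoC, exp_0; reflexivity.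
Qed.

Lemma cpow_minus_1 (x : R) (z : C) : 0 < x -> cpow x (z - 1) = (cpow x z * / x)%C.
Proof.
  intros Hx; unfold Cminus; rewrite cpow_plus, <- RtoC_opp, cpow_RtoC.
  replace (- (1) * ln x) with (- ln x) by ring.
  now rewrite exp_Ropp, exp_ln, RtoC_inv by lra.
Qed.

Lemma is_Cderive_cpow (c : R) (z : C) (t : R) : 0 < c + t ->
  is_Cderive (fun t => cpow (c + t) z) t (z * cpow (c + t) (z - 1))%C.
Proof.
  intros Hpos.
  apply (is_derive_ext (V := C_R_NormedModule) (fun t => cexp (z * RtoC (ln (c + t))))).
  { intros u; now rewrite cpow_cexp. }
  replace (z * cpow (c + t) (z - 1))%C
    with (scal (/ (c + t)) (z * cexp (z * RtoC (ln (c + t))) : C_R_NormedModule)%C).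
  2:{ rewrite scal_R_Cmult, cpow_minus_1, cpow_cexp by exact Hpos; rewrite RtoC_inv by lra.
      change (/ (c + t)%R * (z * cexp (z * ln (c + t)))
              = z * (cexp (z * ln (c + t)) * / (c + t)%R))%C.
      ring. }
  apply (is_derive_comp (V := C_R_NormedModule) (fun y => cexp (z * RtoC y)));
    [apply is_Cderive_cexp_line|].
  auto_derive; [exact Hpos|field; lra].
Qed.

Lemma Ccontinuous_cpow (c : R) (z : C) (t : R) : 0 < c + t ->
  Ccontinuous (fun t => cpow (c + t) z) t.
Proof.
  intros H; apply (ex_derive_continuous (V := C_R_NormedModule)).
  eexists; now apply is_Cderive_cpow.
Qed.

Lemma ln_nonneg (x : R) : 1 <= x -> 0 <= ln x.
Proof. intros Hx; rewrite <- ln_1; apply ln_le; lra. Qed.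

Lemma cpow_remainder (x : R) (z h : C) : 1 <= x ->
  Cmod (cpow x (z + h) - cpow x z - ln x * cpow x z * h)
  <= exp ((Re z + Cmod h) * ln x) * ln x ^ 2 * Cmod h ^ 2.
Proof.
  intros Hx; pose proof (ln_nonneg x Hx).
  rewrite cpow_plus, (cpow_cexp x h).
  replace (cpow x z * cexp (h * ln x) - cpow x z - ln x * cpow x z * h)%C
    with (cpow x z * (cexp (h * ln x) - 1 - h * ln x))%C by ring.
  rewrite Cmod_mult, Cmod_cpow, Rmult_plus_distr_r, exp_plus, !Rmult_assoc.
  apply Rmult_le_compat_l; [left; apply exp_pos|].
  apply Rle_trans with (1 := cexp_remainder (h * ln x)).
  rewrite Cmod_mult, Cmod_R, Rabs_pos_eq by assumption.
  right; ring.
Qed.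

(** * Goursat's theorem on rectangles *)

Lemma is_lim_seq_div_pow2 (W : R) : is_lim_seq (fun k => W / 2 ^ k) 0.
Proof.
  apply (is_lim_seq_ext (fun k => W * (/ 2) ^ k)).
  { intros k; now rewrite pow_inv. }
  replace (Finite 0) with (Rbar_mult W 0) by (simpl; now rewrite Rmult_0_r).
  apply is_lim_seq_scal_l, is_lim_seq_geom; rewrite Rabs_pos_eq; lra.
Qed.

Lemma div_pow2_ge_0 (W : R) (k : nat) : 0 <= W -> 0 <= W / 2 ^ k.
Proof. intros HW; apply Rdiv_le_0_compat; [exact HW|apply pow_lt; lra]. Qed.

Lemma div_pow2_S (W : R) (k : nat) : W / 2 ^ k = W / 2 ^ S k + W / 2 ^ S k.
Proof. simpl; field; apply pow_nonzero; lra. Qed.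

Lemma dyadic_nested_intervals (u : nat -> R) (W : R) : 0 <= W ->
  (forall k, u (S k) = u k \/ u (S k) = u k + W / 2 ^ S k) ->
  exists x, forall k, u k <= x <= u k + W / 2 ^ k.
Proof.
  intros HW Hu.
  assert (Hincr : forall k, u k <= u (S k)).
  { intros k; pose proof (div_pow2_ge_0 W (S k) HW); destruct (Hu k); lra. }
  assert (Hdecr : forall k, u (S k) + W / 2 ^ S k <= u k + W / 2 ^ k).
  { intros k; pose proof (div_pow2_ge_0 W (S k) HW); rewrite (div_pow2_S W k).
    destruct (Hu k); lra. }
  destruct (ex_lim_seq_adj u (fun k => u k + W / 2 ^ k) Hincr Hdecr) as [Hex_u [Hex_v Heq]].
  { apply (is_lim_seq_ext (fun k => W / 2 ^ k)); [intros k; ring|apply is_lim_seq_div_pow2]. }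
  apply Lim_seq_correct' in Hex_u; apply Lim_seq_correct' in Hex_v.
  exists (real (Lim_seq u)); intros k; split.
  - now apply is_lim_seq_incr_compare.
  - rewrite Heq; now apply (is_lim_seq_decr_compare (fun k => u k + W / 2 ^ k)).
Qed.

(* [P x y k] is meant as a property of the rectangle of size [width / 2 ^ k] by [height / 2 ^ k]
   with lower left corner [(x, y)]. *)
Section DyadicRectangles.

Variables (a c width height : R) (P : R -> R -> nat -> Prop).
Hypothesis width_nonneg : 0 <= width.
Hypothesis height_nonneg : 0 <= height.
Hypothesis P_dec : forall x y k, {P x y k} + {~ P x y k}.

Definition dyadic_inside (x y : R) (k : nat) : Prop :=
  (a <= x /\ x + width / 2 ^ k <= a + width) /\ (c <= y /\ y + height / 2 ^ k <= c + height).

Hypothesis P_quarters : forall x y k, dyadic_inside x y k ->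
  P x y (S k) -> P (x + width / 2 ^ S k) y (S k) -> P x (y + height / 2 ^ S k) (S k) ->
  P (x + width / 2 ^ S k) (y + height / 2 ^ S k) (S k) -> P x y k.

(* Selects a quarter on which [P] fails: the default is the last one, where [P_quarters] forces
   the failure if there is none on the other three. *)
Definition bad_quarter (k : nat) (p : R * R) : R * R :=
  let (x, y) := p in
  let x' := x + width / 2 ^ S k in let y' := y + height / 2 ^ S k in
  if P_dec x y (S k) then
    if P_dec x' y (S k) then if P_dec x y' (S k) then (x', y') else (x, y') else (x', y)
  else (x, y).

Definition bad_corner : nat -> R * R := nat_rect (fun _ => (R * R)%type) (a, c) bad_quarter.

Lemma bad_corner_step (k : nat) :
  (fst (bad_corner (S k)) = fst (bad_corner k) \/
   fst (bad_corner (S k)) = fst (bad_corner k) + width / 2 ^ S k) /\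
  (snd (bad_corner (S k)) = snd (bad_corner k) \/
   snd (bad_corner (S k)) = snd (bad_corner k) + height / 2 ^ S k).
Proof.
  change (bad_corner (S k)) with (bad_quarter k (bad_corner k)); unfold bad_quarter.
  destruct (bad_corner k) as [x y]; repeat destruct P_dec; simpl; auto.
Qed.

Lemma bad_corner_inside (k : nat) : dyadic_inside (fst (bad_corner k)) (snd (bad_corner k)) k.
Proof.
  unfold dyadic_inside; induction k as [|k IH]; [simpl; rewrite !Rdiv_1_r; lra|].
  rewrite (div_pow2_S width k), (div_pow2_S height k) in IH.
  pose proof (div_pow2_ge_0 width (S k) width_nonneg).
  pose proof (div_pow2_ge_0 height (S k) height_nonneg).
  destruct (bad_corner_step k) as [[-> | ->] [-> | ->]]; lra.
Qed.

Lemma bad_corner_bad (k : nat) : ~ P a c 0 -> ~ P (fst (bad_corner k)) (snd (bad_corner k)) k.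
Proof.
  intros Hroot; induction k as [|k IH]; [exact Hroot|].
  pose proof (bad_corner_inside k) as Hin; pose proof (P_quarters _ _ _ Hin) as Hquarters.
  change (bad_corner (S k)) with (bad_quarter k (bad_corner k)); unfold bad_quarter.
  destruct (bad_corner k) as [x y]; simpl fst in *; simpl snd in *.
  repeat destruct P_dec; simpl fst; simpl snd; auto.
Qed.

Theorem dyadic_rectangle_induction :
  (forall u v, a <= u <= a + width -> c <= v <= c + height ->
     exists k, forall x y, dyadic_inside x y k ->
     x <= u <= x + width / 2 ^ k -> y <= v <= y + height / 2 ^ k -> P x y k) ->
  P a c 0.
Proof.
  intros Hlocal; destruct (P_dec a c 0) as [Hroot|Hroot]; [exact Hroot|exfalso].
  destruct (dyadic_nested_intervals (fun k => fst (bad_corner k)) width) as [u Hu];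
    [exact width_nonneg|intros k; apply bad_corner_step|].
  destruct (dyadic_nested_intervals (fun k => snd (bad_corner k)) height) as [v Hv];
    [exact height_nonneg|intros k; apply bad_corner_step|].
  assert (Hu0 := Hu 0%nat); assert (Hv0 := Hv 0%nat); simpl in Hu0, Hv0.
  rewrite Rdiv_1_r in Hu0, Hv0.
  destruct (Hlocal u v Hu0 Hv0) as [k Hk].
  apply (bad_corner_bad k Hroot), Hk; [apply bad_corner_inside|apply Hu|apply Hv].
Qed.

End DyadicRectangles.

Definition rect_integral (f : C -> C) (a b c d : R) : C :=
  (CInt (fun x => f (x, c)) a b - CInt (fun x => f (x, d)) a b
   + Ci * (CInt (fun y => f (b, y)) c d - CInt (fun y => f (a, y)) c d))%C.

Lemma Ccontinuous_RtoC (t : R) : Ccontinuous RtoC t.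
Proof. apply Ccontinuous_pair; [apply continuous_id|apply continuous_const]. Qed.

Lemma is_CInt_affine (a b : R) (k l : C) : a <= b ->
  is_CInt (fun t => k + l * t)%C a b (k * (b - a) + l * (b ^ 2 - a ^ 2) / 2)%C.
Proof.
  intros Hab; set (F := fun t : R => (k * t + l * t ^ 2 / 2)%C).
  replace (k * (b - a) + l * (b ^ 2 - a ^ 2) / 2)%C with (F b - F a)%C by (unfold F, Cdiv; ring).
  apply is_CInt_derive; [exact Hab| |].
  - intros t _; apply (is_derive_ext (V := C_R_NormedModule)
      (fun t => (fst k * t + fst l * t ^ 2 / 2, snd k * t + snd l * t ^ 2 / 2))).
    { intros u; unfold F, Cdiv; rewrite <- RtoC_pow, <- RtoC_inv by lra.
      apply injective_projections; simpl; field. }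
    replace (k + l * t)%C with (fst k + fst l * t, snd k + snd l * t)
      by (apply injective_projections; simpl; ring).
    apply is_Cderive_pair; auto_derive; trivial; simpl; field.
  - intros t _; apply (holo_at_Ccontinuous (fun z => k + l * z)%C); [auto with holo|].
    apply Ccontinuous_RtoC.
Qed.

Lemma CInt_near_affine (f : R -> C) (a b : R) (k l : C) (e : R) : a <= b -> ex_CInt f a b ->
  (forall t, a <= t <= b -> Cmod (f t - (k + l * t)) <= e) ->
  Cmod (CInt f a b - (k * (b - a) + l * (b ^ 2 - a ^ 2) / 2)) <= (b - a) * e.
Proof.
  intros Hab Hf; apply Cmod_is_CInt_le; [exact Hab|].
  apply is_CInt_minus; [now apply CInt_correct|now apply is_CInt_affine].
Qed.

Section Goursat.

Variables (f : C -> C) (a0 b0 c0 d0 : R).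
Hypothesis f_holo : forall x y, a0 <= x <= b0 -> c0 <= y <= d0 -> holo_at f (x, y).

Lemma ex_CInt_horizontal (a b y : R) :
  a0 <= a -> a <= b -> b <= b0 -> c0 <= y <= d0 -> ex_CInt (fun x => f (x, y)) a b.
Proof.
  intros Ha Hab Hb Hy; apply ex_CInt_Ccontinuous; [exact Hab|]; intros x Hx.
  apply (holo_at_Ccontinuous f (fun x => (x, y))); [apply f_holo; lra|].
  apply Ccontinuous_pair; [apply continuous_id|apply continuous_const].
Qed.

Lemma ex_CInt_vertical (c d x : R) :
  c0 <= c -> c <= d -> d <= d0 -> a0 <= x <= b0 -> ex_CInt (fun y => f (x, y)) c d.
Proof.
  intros Hc Hcd Hd Hx; apply ex_CInt_Ccontinuous; [exact Hcd|]; intros y Hy.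
  apply (holo_at_Ccontinuous f (fun y => (x, y))); [apply f_holo; lra|].
  apply Ccontinuous_pair; [apply continuous_const|apply continuous_id].
Qed.

Lemma rect_integral_quarters (a m b c n d : R) :
  a0 <= a -> a <= m -> m <= b -> b <= b0 -> c0 <= c -> c <= n -> n <= d -> d <= d0 ->
  rect_integral f a b c d =
    (rect_integral f a m c n + rect_integral f m b c n
     + rect_integral f a m n d + rect_integral f m b n d)%C.
Proof.
  intros; unfold rect_integral.
  rewrite (CInt_Chasles (fun x => f (x, c)) a m b) by (apply ex_CInt_horizontal; lra).
  rewrite (CInt_Chasles (fun x => f (x, d)) a m b) by (apply ex_CInt_horizontal; lra).
  rewrite (CInt_Chasles (fun y => f (b, y)) c n d) by (apply ex_CInt_vertical; lra).
  rewrite (CInt_Chasles (fun y => f (a, y)) c n d) by (apply ex_CInt_vertical; lra).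
  ring.
Qed.

(* The integral of [k + l z] around a rectangle vanishes. *)
Lemma rect_integral_near_affine (a b c d : R) (k l : C) (e : R) :
  a0 <= a -> a <= b -> b <= b0 -> c0 <= c -> c <= d -> d <= d0 ->
  (forall x y, a <= x <= b -> c <= y <= d -> Cmod (f (x, y) - (k + l * (x, y))) <= e) ->
  Cmod (rect_integral f a b c d) <= 2 * ((b - a) + (d - c)) * e.
Proof.
  intros Ha Hab Hb Hc Hcd Hd He.
  set (hor := fun y : R =>
    (CInt (fun x => f (x, y)) a b - ((k + l * Ci * y) * (b - a) + l * (b ^ 2 - a ^ 2) / 2))%C).
  set (ver := fun x : R =>
    (CInt (fun y => f (x, y)) c d - ((k + l * x) * (d - c) + l * Ci * (d ^ 2 - c ^ 2) / 2))%C).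
  assert (Hhor : forall y, c <= y <= d -> Cmod (hor y) <= (b - a) * e).
  { intros y Hy; apply (CInt_near_affine (fun x => f (x, y)) a b (k + l * Ci * y)%C l e);
      [exact Hab|apply ex_CInt_horizontal; lra|].
    intros x Hx; replace (k + l * Ci * y + l * x)%C with (k + l * (x, y))%C
      by (apply injective_projections; simpl; ring).
    now apply He. }
  assert (Hver : forall x, a <= x <= b -> Cmod (ver x) <= (d - c) * e).
  { intros x Hx; apply (CInt_near_affine (fun y => f (x, y)) c d (k + l * x)%C (l * Ci)%C e);
      [exact Hcd|apply ex_CInt_vertical; lra|].
    intros y Hy; replace (k + l * x + l * Ci * y)%C with (k + l * (x, y))%C
      by (apply injective_projections; simpl; ring).
    now apply He. }
  replace (rect_integral f a b c d) with (hor c - hor d + Ci * (ver b - ver a))%C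
    by (unfold rect_integral, hor, ver, Cdiv; ring).
  apply Rle_trans with (1 := Cmod_triangle _ _); rewrite Cmod_mult, Cmod_Ci, Rmult_1_l.
  pose proof (Cmod_minus_le (hor c) (hor d)); pose proof (Cmod_minus_le (ver b) (ver a)).
  pose proof (Hhor c ltac:(lra)); pose proof (Hhor d ltac:(lra)).
  pose proof (Hver a ltac:(lra)); pose proof (Hver b ltac:(lra)).
  lra.
Qed.

Lemma rect_integral_local (u v eps : R) : a0 <= u <= b0 -> c0 <= v <= d0 -> 0 < eps ->
  exists del, 0 < del /\
  forall a b c d, a0 <= a -> a <= u <= b -> b <= b0 -> c0 <= c -> c <= v <= d -> d <= d0 ->
    (b - a) + (d - c) < del ->
    Cmod (rect_integral f a b c d) <= eps * ((b - a) + (d - c)) ^ 2.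
Proof.
  intros Hu Hv Heps.
  destruct (proj1 (holo_at_iff f (u, v)) (f_holo u v Hu Hv)) as [l Hl].
  destruct (Hl (eps / 2)) as [del [Hdel Hdiff]]; [lra|].
  exists del; split; [exact Hdel|]; intros a b c d Ha Hab Hb Hc Hcd Hd Hsize.
  set (s := (b - a) + (d - c)) in *.
  replace (eps * s ^ 2) with (2 * s * (eps / 2 * s)) by field.
  apply (rect_integral_near_affine a b c d (f (u, v) - l * (u, v))%C l); try lra.
  intros x y Hx Hy.
  assert (Hdist : Cmod ((x, y) - (u, v)) <= s).
  { apply Rle_trans with (1 := Cmod_le_Rabs_sum _); simpl.
    assert (Rabs (x - u) <= b - a) by (apply Rabs_le; lra).
    assert (Rabs (y - v) <= d - c) by (apply Rabs_le; lra).
    unfold s, Rminus in *; lra. }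
  replace (f (x, y) - (f (u, v) - l * (u, v) + l * (x, y)))%C
    with (f (x, y) - f (u, v) - l * ((x, y) - (u, v)))%C by ring.
  apply Rle_trans with (1 := Hdiff (x, y) ltac:(lra)).
  apply Rmult_le_compat_l; lra.
Qed.

Lemma Cmod_rect_integral_le (width height eps : R) : 0 <= width -> 0 <= height -> 0 < eps ->
  b0 = a0 + width -> d0 = c0 + height ->
  Cmod (rect_integral f a0 b0 c0 d0) <= eps * (width + height) ^ 2.
Proof.
  intros Hwidth Hheight Heps Hb Hd.
  set (P := fun (x y : R) (k : nat) =>
    Cmod (rect_integral f x (x + width / 2 ^ k) y (y + height / 2 ^ k))
    <= eps * (width / 2 ^ k + height / 2 ^ k) ^ 2).
  enough (HP : P a0 c0 0%nat)
    by (unfold P in HP; simpl (2 ^ 0) in HP; rewrite !Rdiv_1_r in HP; now rewrite Hb, Hd).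
  apply (dyadic_rectangle_induction a0 c0 width height); [exact Hwidth|exact Hheight| | |].
  - intros x y k; apply Rle_dec.
  - intros x y k [Hx Hy] Psw Pse Pnw Pne; unfold P in *.
    pose proof (div_pow2_ge_0 width (S k) Hwidth); pose proof (div_pow2_ge_0 height (S k) Hheight).
    rewrite (div_pow2_S width k), (div_pow2_S height k) in *.
    set (w := width / 2 ^ S k) in *; set (h := height / 2 ^ S k) in *.
    rewrite (rect_integral_quarters x (x + w) _ y (y + h)) by lra.
    replace (eps * (w + w + (h + h)) ^ 2) with (4 * (eps * (w + h) ^ 2)) by ring.
    rewrite <- !Rplus_assoc.
    now apply Cmod_plus4_le.
  - intros u v Hu Hv.
    destruct (rect_integral_local u v eps) as [del [Hdel Hlocal]]; [lra|lra|exact Heps|].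
    pose proof (proj2 (is_lim_seq_spec _ _) (is_lim_seq_div_pow2 (width + height))) as Hlim.
    destruct (Hlim (mkposreal del Hdel)) as [k Hk].
    specialize (Hk k (le_n k)); simpl in Hk; apply Rabs_lt_between in Hk.
    exists k; intros x y [Hx Hy] Hux Hvy; unfold P.
    pose proof (Hlocal x (x + width / 2 ^ k) y (y + height / 2 ^ k)) as Hxy.
    replace (x + width / 2 ^ k - x + (y + height / 2 ^ k - y))
      with (width / 2 ^ k + height / 2 ^ k) in Hxy by ring.
    apply Hxy; try lra; unfold Rdiv in *; lra.
Qed.

Theorem rect_integral_eq_0 : a0 <= b0 -> c0 <= d0 -> rect_integral f a0 b0 c0 d0 = 0.
Proof.
  intros Hab Hcd; apply Cmod_eq_0, Rle_antisym; [|apply Cmod_ge_0].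
  set (S := (b0 - a0 + (d0 - c0)) ^ 2); assert (HS : 0 <= S) by apply pow2_ge_0.
  apply Rle_plus_epsilon; intros eps Heps; rewrite Rplus_0_l.
  apply Rle_trans with (eps / (S + 1) * S).
  - apply Cmod_rect_integral_le; try lra; apply Rdiv_lt_0_compat; lra.
  - replace eps with (eps / (S + 1) * (S + 1)) at 2 by (field; lra).
    apply Rmult_le_compat_l; [left; apply Rdiv_lt_0_compat|]; lra.
Qed.

Lemma Cmod_CInt_top_le : a0 <= b0 -> c0 <= d0 ->
  (forall x, a0 <= x <= b0 -> f (x, c0) = 0) ->
  Cmod (CInt (fun x => f (x, d0)) a0 b0)
  <= Cmod (CInt (fun y => f (a0, y)) c0 d0) + Cmod (CInt (fun y => f (b0, y)) c0 d0).
Proof.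
  intros Hab Hcd Hbottom; pose proof (rect_integral_eq_0 Hab Hcd) as Hgoursat.
  unfold rect_integral in Hgoursat.
  rewrite (RInt_ext (V := C_R_CompleteNormedModule) (fun x => f (x, c0)) (fun _ => RtoC 0))
    in Hgoursat.
  2:{ intros x; rewrite Rmin_left, Rmax_right by exact Hab; intros Hx; apply Hbottom; lra. }
  rewrite RInt_const, scal_R_Cmult, Cmult_0_r in Hgoursat.
  set (top := CInt (fun x => f (x, d0)) a0 b0) in *.
  set (right := CInt (fun y => f (b0, y)) c0 d0) in *.
  set (left := CInt (fun y => f (a0, y)) c0 d0) in *.
  replace top with (Ci * (right - left))%C by (apply Ceq_minus; rewrite <- Hgoursat; ring).
  rewrite Cmod_mult, Cmod_Ci, Rmult_1_l; pose proof (Cmod_minus_le right left).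
  unfold left, right in *; lra.
Qed.

End Goursat.

(** * Uniqueness of continuation to a punctured disc *)

Lemma continuous_norm_bounded {V : NormedModule R_AbsRing} (f : R -> V) (a b : R) : a <= b ->
  (forall t, a <= t <= b -> continuous f t) ->
  exists M, 0 <= M /\ forall t, a <= t <= b -> norm (f t) <= M.
Proof.
  intros Hab Hf.
  destruct (continuity_ab_maj (fun t => norm (f t)) a b Hab) as [t0 [Hmax _]].
  - intros t Ht; apply continuity_pt_filterlim.
    apply (continuous_comp f norm); [now apply Hf|apply filterlim_norm].
  - exists (norm (f t0)); split; [apply norm_ge_0|exact Hmax].
Qed.

Lemma RInt_ge_const (f : R -> R) (a b m : R) : a <= b -> ex_RInt f a b ->
  (forall x, a <= x <= b -> m <= f x) -> (b - a) * m <= RInt f a b.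
Proof.
  intros Hab Hf Hm.
  replace ((b - a) * m) with (RInt (fun _ => m) a b) by (rewrite RInt_const; reflexivity).
  apply RInt_le; [exact Hab|apply ex_RInt_const|exact Hf|intros; apply Hm; lra].
Qed.

Lemma ex_RInt_gaussian (psi : R -> R) (x0 lam a b : R) : a <= b ->
  (forall x, a <= x <= b -> continuous psi x) ->
  ex_RInt (fun x => psi x * exp (- lam * (x - x0) ^ 2)) a b.
Proof.
  intros Hab Hpsi; apply (ex_RInt_continuous (V := R_CompleteNormedModule)); intros x Hx.
  rewrite Rmin_left, Rmax_right in Hx by exact Hab.
  apply (continuous_mult psi); [now apply Hpsi|].
  apply (ex_derive_continuous (V := R_NormedModule)); auto_derive; trivial.
Qed.

Lemma RInt_gaussian_ge (psi : R -> R) (x0 T M m del lam : R) : 0 < del <= T -> 0 <= m ->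
  0 <= M -> 0 <= lam ->
  (forall x, x0 - T <= x <= x0 + T -> continuous psi x) ->
  (forall x, x0 - T <= x <= x0 + T -> - M <= psi x) ->
  (forall x, x0 - del <= x <= x0 + del -> m <= psi x) ->
  del * m * exp (- lam * (del ^ 2 / 4)) - 2 * T * M * exp (- lam * del ^ 2)
  <= RInt (fun x => psi x * exp (- lam * (x - x0) ^ 2)) (x0 - T) (x0 + T).
Proof.
  intros Hdel Hm HM0 Hlam Hcont HM Hnear; set (g := fun x => psi x * exp (- lam * (x - x0) ^ 2)).
  assert (Hg : forall a b, x0 - T <= a -> a <= b -> b <= x0 + T -> ex_RInt g a b)
    by (intros; apply ex_RInt_gaussian; [assumption|intros; apply Hcont; lra]).
  assert (Hfar : forall x, x0 - T <= x <= x0 + T -> - M * exp (- lam * del ^ 2) <= g x).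
  { intros x Hx; unfold g; pose proof (exp_pos (- lam * (x - x0) ^ 2)) as Hexp.
    pose proof (exp_pos (- lam * del ^ 2)).
    destruct (Rle_dec (Rabs (x - x0)) del) as [Hin|Hout].
    - apply Rabs_le_between in Hin; specialize (Hnear x ltac:(lra)); nra.
    - apply Rnot_le_lt in Hout; specialize (HM x Hx).
      assert (del ^ 2 <= (x - x0) ^ 2) by (rewrite <- (pow2_abs (x - x0)); apply pow_incr; lra).
      assert (exp (- lam * (x - x0) ^ 2) <= exp (- lam * del ^ 2)) by (apply exp_le; nra).
      nra. }
  assert (Hmiddle : forall x, x0 - del / 2 <= x <= x0 + del / 2 ->
    m * exp (- lam * (del ^ 2 / 4)) <= g x).
  { intros x Hx; unfold g.
    assert ((x - x0) ^ 2 <= del ^ 2 / 4).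
    { rewrite <- (pow2_abs (x - x0)); replace (del ^ 2 / 4) with ((del / 2) ^ 2) by field.
      apply pow_incr; split; [apply Rabs_pos|apply Rabs_le; lra]. }
    apply Rmult_le_compat; [exact Hm|left; apply exp_pos|apply Hnear; lra|apply exp_le; nra]. }
  rewrite <- (RInt_Chasles g (x0 - T) (x0 - del / 2)) by (apply Hg; lra).
  rewrite <- (RInt_Chasles g (x0 - del / 2) (x0 + del / 2)) by (apply Hg; lra).
  pose proof (RInt_ge_const g (x0 - T) (x0 - del / 2) _ ltac:(lra) ltac:(apply Hg; lra)
    (fun x Hx => Hfar x ltac:(lra))).
  pose proof (RInt_ge_const g (x0 - del / 2) (x0 + del / 2) _ ltac:(lra) ltac:(apply Hg; lra)
    Hmiddle).
  pose proof (RInt_ge_const g (x0 + del / 2) (x0 + T) _ ltac:(lra) ltac:(apply Hg; lra)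
    (fun x Hx => Hfar x ltac:(lra))).
  assert (0 <= del * (M * exp (- lam * del ^ 2)))
    by (repeat apply Rmult_le_pos; try lra; left; apply exp_pos).
  unfold plus; cbn -[RInt exp pow]; lra.
Qed.

Lemma exp_decay_comparison (A B a b : R) : a < b ->
  (forall lam, 0 <= lam -> A * exp (- lam * a) <= B * exp (- lam * b)) -> A <= 0.
Proof.
  intros Hab H; apply Rnot_lt_le; intros HA.
  assert (HAB : forall lam, 0 <= lam -> A * (1 + lam * (b - a)) <= B).
  { intros lam Hlam; apply Rle_trans with (A * exp (lam * (b - a))).
    - apply Rmult_le_compat_l; [lra|apply exp_ineq1_le].
    - apply Rmult_le_reg_r with (exp (- lam * b)); [apply exp_pos|].
      rewrite Rmult_assoc, <- exp_plus.
      replace (lam * (b - a) + - lam * b) with (- lam * a) by ring; now apply H. }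
  assert (HB : 0 <= B) by (specialize (HAB 0 (Rle_refl 0)); nra).
  specialize (HAB (B / (A * (b - a)))).
  replace (A * (1 + B / (A * (b - a)) * (b - a))) with (A + B) in HAB by (field; lra).
  assert (A + B <= B); [apply HAB|lra].
  apply Rdiv_le_0_compat; [exact HB|apply Rmult_lt_0_compat; lra].
Qed.

Lemma gaussian_localisation_le (psi : R -> R) (x0 T eta K : R) : 0 < T -> 0 < eta ->
  (forall x, x0 - T <= x <= x0 + T -> continuous psi x) ->
  (forall lam, 0 <= lam ->
     RInt (fun x => psi x * exp (- lam * (x - x0) ^ 2)) (x0 - T) (x0 + T)
     <= K * exp (- lam * eta)) ->
  psi x0 <= 0.
Proof.
  intros HT Heta Hcont Hint; apply Rnot_lt_le; intros Hpos.
  destruct (continuous_norm_bounded psi (x0 - T) (x0 + T)) as [M [HM0 HM]]; [lra|exact Hcont|].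
  assert (Hx0 : continuity_pt psi x0) by (apply continuity_pt_filterlim, Hcont; lra).
  destruct (proj1 (continuity_pt_locally _ _) Hx0 (mkposreal (psi x0 / 2) ltac:(lra)))
    as [al Hal]; simpl in Hal.
  set (del := Rmin (Rmin (al / 2) T) (Rmin 1 eta)).
  assert (Hdel : 0 < del /\ del <= al / 2 /\ del <= T /\ del <= 1 /\ del <= eta).
  { pose proof (cond_pos al).
    unfold del; repeat split; repeat apply Rmin_glb_lt; try lra;
      unfold Rmin; repeat destruct Rle_dec; lra. }
  assert (Hnear : forall x, x0 - del <= x <= x0 + del -> psi x0 / 2 <= psi x).
  { intros x Hx; pose proof (cond_pos al).
    assert (Hball : Rabs (x - x0) < al) by (apply Rabs_lt_between; lra).
    specialize (Hal x Hball); apply Rabs_lt_between in Hal; lra. }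
  enough (del * (psi x0 / 2) <= 0) by nra.
  apply (exp_decay_comparison _ (2 * T * M + Rabs K) (del ^ 2 / 4) (del ^ 2));
    [assert (0 < del ^ 2) by (apply pow_lt; lra); lra|].
  intros lam Hlam; specialize (Hint lam Hlam).
  assert (Hlower := RInt_gaussian_ge psi x0 T M (psi x0 / 2) del lam ltac:(lra) ltac:(lra) HM0
    Hlam Hcont (fun x Hx => proj1 (proj1 (Rabs_le_between _ _) (HM x Hx))) Hnear).
  assert (Hexp : exp (- lam * eta) <= exp (- lam * del ^ 2)).
  { apply exp_le; assert (del ^ 2 <= eta) by (simpl; nra); nra. }
  pose proof (Rle_abs K); pose proof (Rabs_pos K); pose proof (exp_pos (- lam * eta)).
  nra.
Qed.

Lemma gaussian_localisation (psi : R -> C) (x0 T eta K : R) : 0 < T -> 0 < eta ->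
  (forall x, x0 - T <= x <= x0 + T -> Ccontinuous psi x) ->
  (forall lam, 0 <= lam ->
     Cmod (CInt (fun x => exp (- lam * (x - x0) ^ 2) * psi x)%C (x0 - T) (x0 + T))
     <= K * exp (- lam * eta)) ->
  psi x0 = 0.
Proof.
  intros HT Heta Hcont Hint; set (c := psi x0).
  assert (Hgauss : forall lam, ex_CInt (fun x => exp (- lam * (x - x0) ^ 2) * psi x)%C
    (x0 - T) (x0 + T)).
  { intros lam; apply ex_CInt_Ccontinuous; [lra|]; intros x Hx.
    apply (Ccontinuous_Rmult (fun x => exp (- lam * (x - x0) ^ 2))); [|now apply Hcont].
    apply (ex_derive_continuous (V := R_NormedModule)); auto_derive; trivial. }
  assert (Hle : Re (c * Cconj c) <= 0).
  { apply (gaussian_localisation_le (fun x => Re (psi x * Cconj c)) x0 T eta (K * Cmod c) HT Heta).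
    - intros x Hx.
      apply (continuous_comp (V := C_UniformSpace) (fun x => psi x * Cconj c)%C Re).
      + apply (holo_at_Ccontinuous (fun z => z * Cconj c)%C); [auto with holo|now apply Hcont].
      + destruct (psi x * Cconj c)%C; apply continuous_fst.
    - intros lam Hlam.
      set (I := CInt (fun x => exp (- lam * (x - x0) ^ 2) * psi x)%C (x0 - T) (x0 + T)).
      replace (RInt _ _ _) with (Re (I * Cconj c)).
      + apply Rle_trans with (1 := Rle_abs _), Rle_trans with (1 := re_le_Cmod _).
        rewrite Cmod_mult, Cmod_conj; pose proof (Hint lam Hlam); pose proof (Cmod_ge_0 c).
        replace (K * Cmod c * exp (- lam * eta)) with (K * exp (- lam * eta) * Cmod c) by ring.
        now apply Rmult_le_compat_r.
      + symmetry; apply is_RInt_unique.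
        apply (is_RInt_ext (V := R_NormedModule)
          (fun x => fst (exp (- lam * (x - x0) ^ 2) * psi x * Cconj c)%C)).
        { intros x _; rewrite <- re_scal_r; unfold Re; f_equal; ring. }
        apply (is_RInt_fct_extend_fst (U := R_NormedModule) (V := R_NormedModule)).
        now apply is_CInt_mult_r, CInt_correct. }
  apply Cmod_eq_0; rewrite re_mult, re_conj, im_conj in Hle.
  pose proof (Cmod2_alt c); pose proof (Cmod_ge_0 c); simpl in *; nra.
Qed.

Definition gaussian_kernel (lam : R) (w0 w : C) : C := cexp (- lam * ((w - w0) * (w - w0))).

Lemma holo_at_gaussian_kernel (lam : R) (w0 w : C) : holo_at (gaussian_kernel lam w0) w.
Proof.
  apply (holo_at_comp cexp); [apply holo_at_cexp|auto 6 with holo].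
Qed.

Lemma gaussian_kernel_horizontal (lam x0 y0 x : R) :
  gaussian_kernel lam (x0, y0) (x, y0) = RtoC (exp (- lam * (x - x0) ^ 2)).
Proof.
  unfold gaussian_kernel; rewrite <- cexp_RtoC; f_equal.
  apply injective_projections; simpl; ring.
Qed.

Lemma Cmod_gaussian_kernel (lam x0 y0 x y : R) :
  Cmod (gaussian_kernel lam (x0, y0) (x, y)) = exp (- lam * ((x - x0) ^ 2 - (y - y0) ^ 2)).
Proof.
  unfold gaussian_kernel; rewrite Cmod_cexp; f_equal; unfold Re; simpl; ring.
Qed.

Lemma Cmod_CInt_gaussian_vertical_le (phi : C -> C) (lam x0 y0 x M : R) :
  0 <= lam -> 0 <= y0 -> (forall y, 0 <= y <= y0 -> holo_at phi (x, y)) ->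
  (forall y, 0 <= y <= y0 -> Cmod (phi (x, y)) <= M) ->
  Cmod (CInt (fun y => gaussian_kernel lam (x0, y0) (x, y) * phi (x, y))%C 0 y0)
  <= y0 * (exp (- lam * ((x - x0) ^ 2 - y0 ^ 2)) * M).
Proof.
  intros Hlam Hy0 Hholo HM.
  replace (y0 * _) with ((y0 - 0) * (exp (- lam * ((x - x0) ^ 2 - y0 ^ 2)) * M)) by ring.
  set (g := fun w => (gaussian_kernel lam (x0, y0) w * phi w)%C).
  apply (Cmod_is_CInt_le (fun y => g (x, y))); [exact Hy0| |].
  - apply CInt_correct, (ex_CInt_vertical g x x 0 y0); try lra.
    intros x' y Hx' Hy; replace x' with x by lra.
    apply holo_at_mult; [apply holo_at_gaussian_kernel|now apply Hholo].
  - intros y Hy; unfold g; rewrite Cmod_mult, Cmod_gaussian_kernel.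
    apply Rmult_le_compat; [left; apply exp_pos|apply Cmod_ge_0| |now apply HM].
    apply exp_le; assert ((y - y0) ^ 2 <= y0 ^ 2) by (simpl; nra); nra.
Qed.

Lemma holo_vertical_bounded (phi : C -> C) (x y0 : R) : 0 <= y0 ->
  (forall y, 0 <= y <= y0 -> holo_at phi (x, y)) ->
  exists M, forall y, 0 <= y <= y0 -> Cmod (phi (x, y)) <= M.
Proof.
  intros Hy0 Hholo.
  destruct (continuous_norm_bounded (V := C_R_NormedModule) (fun y => phi (x, y)) 0 y0)
    as [M [_ HM]]; [exact Hy0| |].
  - intros y Hy; apply (holo_at_Ccontinuous phi); [now apply Hholo|].
    apply Ccontinuous_pair; [apply continuous_const|apply continuous_id].
  - exists M; intros y Hy; rewrite <- norm_C_R; now apply HM.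
Qed.

(* Against [exp (-lam (w - w0)^2)] the vertical sides contribute exponentially little, because
   the target [w0] is closer to the bottom side than to them. *)
Theorem rectangle_vanishing (phi : C -> C) (x0 y0 T : R) : 0 <= y0 < T ->
  (forall x y, x0 - T <= x <= x0 + T -> 0 <= y <= y0 -> holo_at phi (x, y)) ->
  (forall x, x0 - T <= x <= x0 + T -> phi (x, 0) = 0) ->
  phi (x0, y0) = 0.
Proof.
  intros Hy0 Hholo Hbottom.
  destruct (holo_vertical_bounded phi (x0 - T) y0) as [Ml HMl]; [lra|intros; apply Hholo; lra|].
  destruct (holo_vertical_bounded phi (x0 + T) y0) as [Mr HMr]; [lra|intros; apply Hholo; lra|].
  apply (gaussian_localisation (fun x => phi (x, y0)) x0 T (T ^ 2 - y0 ^ 2) (y0 * (Ml + Mr)));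
    [lra|simpl; nra| |].
  { intros x Hx; apply (holo_at_Ccontinuous phi); [apply Hholo; lra|].
    apply Ccontinuous_pair; [apply continuous_id|apply continuous_const]. }
  intros lam Hlam; set (g := fun w => (gaussian_kernel lam (x0, y0) w * phi w)%C).
  rewrite (RInt_ext (V := C_R_CompleteNormedModule) _ (fun x => g (x, y0))).
  2:{ intros x _; unfold g; now rewrite gaussian_kernel_horizontal. }
  apply Rle_trans with (Cmod (CInt (fun y => g (x0 - T, y)) 0 y0)
    + Cmod (CInt (fun y => g (x0 + T, y)) 0 y0)).
  - apply Cmod_CInt_top_le; [|lra|lra|].
    + intros x y Hx Hy; apply holo_at_mult; [apply holo_at_gaussian_kernel|now apply Hholo].
    + intros x Hx; unfold g; rewrite Hbottom by exact Hx; apply Cmult_0_r.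
  - pose proof (Cmod_CInt_gaussian_vertical_le phi lam x0 y0 (x0 - T) Ml Hlam (proj1 Hy0)
      ltac:(intros; apply Hholo; lra) HMl) as Hleft.
    pose proof (Cmod_CInt_gaussian_vertical_le phi lam x0 y0 (x0 + T) Mr Hlam (proj1 Hy0)
      ltac:(intros; apply Hholo; lra) HMr) as Hright.
    replace ((x0 - T - x0) ^ 2) with (T ^ 2) in Hleft by ring.
    replace ((x0 + T - x0) ^ 2) with (T ^ 2) in Hright by ring.
    unfold g; lra.
Qed.

Section LeftHalfPlane.

Variables (phi : C -> C) (X : R).
Hypothesis phi_holo : forall x y, x < X -> holo_at phi (x, y).

Lemma vanishing_above_real_axis (x y : R) : (forall x, x < X -> phi (x, 0) = 0) ->
  0 <= y -> x + y < X -> phi (x, y) = 0.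
Proof.
  intros Hreal Hy Hxy; apply (rectangle_vanishing phi x y ((y + (X - x)) / 2)); [lra| |].
  - intros; apply phi_holo; lra.
  - intros; apply Hreal; lra.
Qed.

(* The rectangle is rotated by a right angle, and may be taken as tall as needed. *)
Lemma vanishing_right_of_vertical_line (x1 x y : R) :
  (forall y, phi (x1, y) = 0) -> x1 <= x < X -> phi (x, y) = 0.
Proof.
  intros Hline Hx.
  set (rot := fun w : C => (x1 - Ci * w)%C).
  assert (Hrot : forall a b, rot (a, b) = (x1 + b, - a))
    by (intros; apply injective_projections; simpl; ring).
  replace (x, y) with (rot (- y, x - x1)) by (rewrite Hrot; f_equal; ring).
  apply (rectangle_vanishing (fun w => phi (rot w)) (- y) (x - x1) (x - x1 + 1)); [lra| |].
  - intros a b Ha Hb; apply (holo_at_comp phi rot); [|unfold rot; auto with holo].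
    rewrite Hrot; apply phi_holo; lra.
  - intros a Ha; now rewrite Hrot, Rplus_0_r.
Qed.

End LeftHalfPlane.

Lemma unit_circle_angle (a b : R) : a ^ 2 + b ^ 2 = 1 ->
  exists t, 0 <= t <= 2 * PI /\ cos t = a /\ sin t = b.
Proof.
  intros Hab; assert (Ha : -1 <= a <= 1) by (split; nra).
  assert (Hsqrt : sqrt (1 - a²) = Rabs b)
    by (replace (1 - a²) with (b²) by (unfold Rsqr; lra); apply sqrt_Rsqr_abs).
  pose proof (acos_bound a) as Hacos.
  destruct (Rle_dec 0 b) as [Hb|Hb].
  - exists (acos a); rewrite cos_acos, sin_acos, Hsqrt, Rabs_pos_eq by assumption.
    split; [lra|split; reflexivity].
  - exists (2 * PI - acos a).
    rewrite cos_minus, sin_minus, cos_2PI, sin_2PI, cos_acos, sin_acos, Hsqrt, Rabs_left by lra.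
    split; [lra|split; ring].
Qed.

Lemma polar_form (z : C) : z <> 0 -> exists t, 0 <= t <= 2 * PI /\ z = cexp (ln (Cmod z), t).
Proof.
  intros Hz; pose proof (proj1 (Cmod_gt_0 z) Hz) as Hpos.
  destruct (unit_circle_angle (Re z / Cmod z) (Im z / Cmod z)) as [t [Ht [Hcos Hsin]]].
  { replace ((Re z / Cmod z) ^ 2 + (Im z / Cmod z) ^ 2)
      with ((Re z ^ 2 + Im z ^ 2) / Cmod z ^ 2) by (field; lra).
    rewrite Cmod2_alt; apply Rdiv_diag; rewrite <- Cmod2_alt; apply pow_nonzero; lra. }
  exists t; split; [exact Ht|].
  unfold cexp; simpl Re; simpl Im; rewrite exp_ln, Hcos, Hsin by exact Hpos.
  apply injective_projections; unfold Re, Im; simpl; field; lra.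
Qed.

(* With [s = a + exp w] the punctured disc unrolls to a left half plane.  There [f] vanishes on
   the real axis, hence on a cone above it that contains a full period of every vertical line
   far to the left, hence everywhere. *)
Theorem punctured_disc_vanishing (f : C -> C) (a : C) (Rad : R) :
  (forall s, 0 < Cmod (s - a) < Rad -> holo_at f s) ->
  (forall r : R, 0 < r < Rad -> f (a + r)%C = 0) ->
  forall s, 0 < Cmod (s - a) < Rad -> f s = 0.
Proof.
  intros Hholo Hzero s Hs; set (phi := fun w => f (a + cexp w)%C).
  assert (Hexp : forall x, x < ln Rad -> exp x < Rad).
  { intros x Hx; rewrite <- (exp_ln Rad) by lra; now apply exp_increasing. }
  assert (Hphi : forall x y, x < ln Rad -> holo_at phi (x, y)).
  { intros x y Hx; apply (holo_at_comp f (fun w => a + cexp w)%C).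
    - apply Hholo; replace (a + cexp (x, y) - a)%C with (cexp (x, y)) by ring.
      rewrite Cmod_cexp; split; [apply exp_pos|now apply Hexp].
    - apply holo_at_plus; [apply holo_at_const|apply holo_at_cexp]. }
  assert (Hreal : forall x, x < ln Rad -> phi (x, 0) = 0).
  { intros x Hx; unfold phi; change (x, 0) with (RtoC x); rewrite cexp_RtoC.
    apply Hzero; split; [apply exp_pos|now apply Hexp]. }
  destruct (polar_form (s - a)) as [t [_ Ht]]; [apply Cmod_gt_0; lra|].
  assert (Hln : ln (Cmod (s - a)) < ln Rad) by (apply ln_increasing; lra).
  replace s with (a + cexp (ln (Cmod (s - a)), t))%C by (rewrite <- Ht; ring).
  apply (vanishing_right_of_vertical_line phi (ln Rad) Hphi (ln (Cmod (s - a)) - 2 * PI));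
    [|pose proof PI_RGT_0; lra].
  intros y; set (x1 := ln (Cmod (s - a)) - 2 * PI).
  destruct (polar_form (cexp (x1, y))) as [u [Hu Heq]].
  { apply Cmod_gt_0; rewrite Cmod_cexp; apply exp_pos. }
  rewrite Cmod_cexp, ln_exp in Heq; unfold phi; rewrite Heq.
  apply (vanishing_above_real_axis phi (ln Rad) Hphi x1 u Hreal); unfold x1, Re; simpl; lra.
Qed.

(** * Bernoulli numbers and polynomials *)

Fixpoint bern_table (n : nat) : nat -> R :=
  match n with
  | O => fun _ => 1
  | S m => fun j => if (j <=? m)%nat then bern_table m j
      else - sum_f_R0 (fun i => bern_table m i / INR (fact (m + 2 - i))) m
  end.

(* [bern j] is B_j / j! with the convention B_1 = -1/2, and [bern_poly k x] is B_k(x) / k!. *)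
Definition bern (n : nat) : R := bern_table n n.

Definition bern_poly (k : nat) (x : R) : R :=
  sum_f_R0 (fun i => bern i * x ^ (k - i) / INR (fact (k - i))) k.

Lemma bern_table_eq (n j : nat) : (j <= n)%nat -> bern_table n j = bern j.
Proof.
  induction 1 as [|n Hle IH]; [reflexivity|].
  cbn [bern_table]; replace (j <=? n)%nat with true by (symmetry; now apply Nat.leb_le); exact IH.
Qed.

Lemma bern_S (m : nat) : bern (S m) = - sum_f_R0 (fun i => bern i / INR (fact (m + 2 - i))) m.
Proof.
  unfold bern at 1; cbn [bern_table].
  replace (S m <=? m)%nat with false by (symmetry; apply Nat.leb_gt; lia).
  f_equal; apply sum_eq; intros i Hi; now rewrite bern_table_eq.
Qed.

Lemma bern_0 : bern 0 = 1.
Proof. reflexivity. Qed.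

Lemma bern_1 : bern 1 = - (1 / 2).
Proof. rewrite bern_S; simpl; rewrite bern_0; field. Qed.

Lemma INR_fact_S (n : nat) : INR (fact (S n)) = (INR n + 1) * INR (fact n).
Proof. rewrite fact_simpl, mult_INR, S_INR; reflexivity. Qed.

Lemma bern_poly_S (k : nat) (x : R) :
  bern_poly (S k) x
  = sum_f_R0 (fun i => bern i * x ^ S (k - i) / INR (fact (S (k - i)))) k + bern (S k).
Proof.
  unfold bern_poly; rewrite tech5; f_equal.
  - apply sum_eq; intros i Hi; now rewrite Nat.sub_succ_l.
  - rewrite Nat.sub_diag; simpl; field.
Qed.

Lemma bern_poly_deg0 (x : R) : bern_poly 0 x = 1.
Proof. unfold bern_poly; simpl; rewrite bern_0; field. Qed.

Lemma bern_poly_deg1 (x : R) : bern_poly 1 x = x - 1 / 2.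
Proof. rewrite bern_poly_S; simpl; rewrite bern_0, bern_1; field. Qed.

Lemma bern_poly_at_0 (k : nat) : bern_poly k 0 = bern k.
Proof.
  destruct k as [|k]; [apply bern_poly_deg0|].
  rewrite bern_poly_S, (sum_eq _ (fun _ => 0)); [rewrite sum_cte; ring|].
  intros i _; simpl; unfold Rdiv; ring.
Qed.

Lemma bern_poly_at_1 (k : nat) : (2 <= k)%nat -> bern_poly k 1 = bern k.
Proof.
  intros Hk; destruct k as [|[|m]]; [lia|lia|].
  rewrite bern_poly_S, tech5, (sum_eq _ (fun i => bern i / INR (fact (m + 2 - i)))).
  - rewrite (bern_S m), Nat.sub_diag; simpl; field.
  - intros i Hi; rewrite pow1, Rmult_1_r.
    now replace (S (S m - i)) with (m + 2 - i)%nat by lia.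
Qed.

Lemma is_derive_divided_power (c : R) (i : nat) (x : R) :
  is_derive (fun x => c * x ^ S i / INR (fact (S i))) x (c * x ^ i / INR (fact i)).
Proof.
  pose proof (INR_fact_neq_0 i); pose proof (pos_INR i); rewrite INR_fact_S.
  auto_derive; [trivial|].
  change (pred (S i)) with i; change (match i with O => 1 | S _ => INR i + 1 end) with (INR (S i)).
  rewrite S_INR; field; split; [assumption|lra].
Qed.

Lemma is_derive_sum_f_R0 (f df : nat -> R -> R) (n : nat) (x : R) :
  (forall i, (i <= n)%nat -> is_derive (f i) x (df i x)) ->
  is_derive (fun x => sum_f_R0 (fun i => f i x) n) x (sum_f_R0 (fun i => df i x) n).
Proof.
  induction n as [|n IH]; intros H; [now apply H|]; simpl.
  apply (is_derive_plus (V := R_NormedModule)); [apply IH; auto|now apply H].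
Qed.

Lemma is_derive_bern_poly (k : nat) (x : R) : is_derive (bern_poly (S k)) x (bern_poly k x).
Proof.
  apply (is_derive_ext (fun x =>
    sum_f_R0 (fun i => bern i * x ^ S (k - i) / INR (fact (S (k - i)))) k + bern (S k))).
  { intros t; now rewrite bern_poly_S. }
  rewrite <- (Rplus_0_r (bern_poly k x)).
  apply (is_derive_plus (V := R_NormedModule)); [|apply (is_derive_const (V := R_NormedModule))].
  apply (is_derive_sum_f_R0 (fun i x => bern i * x ^ S (k - i) / INR (fact (S (k - i))))
    (fun i x => bern i * x ^ (k - i) / INR (fact (k - i)))).
  intros i _; apply is_derive_divided_power.
Qed.

Lemma continuous_bern_poly (k : nat) (x : R) : continuous (bern_poly k) x.
Proof.
  destruct k as [|k].
  - apply continuous_ext with (fun _ => 1); [intros t; now rewrite bern_poly_deg0|].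
    apply continuous_const.
  - apply (ex_derive_continuous (V := R_NormedModule)); eexists; apply is_derive_bern_poly.
Qed.

Lemma is_derive_0_const (f : R -> R) : (forall x, is_derive f x 0) -> forall x y, f x = f y.
Proof.
  intros H x y; destruct (Rtotal_order x y) as [Hlt|[-> |Hlt]]; [|reflexivity|symmetry];
    apply (eq_is_derive (V := R_NormedModule)); auto.
Qed.

Lemma bern_poly_shift (k : nat) (x : R) :
  bern_poly (S k) (x + 1) - bern_poly (S k) x = x ^ k / INR (fact k).
Proof.
  revert x; induction k as [|k IH]; intros x.
  - rewrite !bern_poly_deg1; simpl; field.
  - set (f := fun x => bern_poly (S (S k)) (x + 1) - bern_poly (S (S k)) x
                       - 1 * x ^ S k / INR (fact (S k))).
    enough (f x = 0) by (unfold f in *; lra).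
    rewrite (is_derive_0_const f) with (y := 0).
    + unfold f; rewrite Rplus_0_l, bern_poly_at_1, bern_poly_at_0 by lia.
      simpl pow; unfold Rdiv; ring.
    + intros t; replace 0 with (1 * bern_poly (S k) (t + 1) - bern_poly (S k) t
        - 1 * t ^ k / INR (fact k)) by (specialize (IH t); lra).
      apply (is_derive_minus (V := R_NormedModule)); [|apply is_derive_divided_power].
      apply (is_derive_minus (V := R_NormedModule)); [|apply is_derive_bern_poly].
      apply (is_derive_comp (V := R_NormedModule) (bern_poly (S (S k))));
        [apply is_derive_bern_poly|auto_derive; trivial].
Qed.

Lemma is_derive_bern_poly_reflect (k : nat) (x : R) :
  is_derive (fun x => bern_poly (S k) (1 - x) - (-1) ^ S k * bern_poly (S k) x) x
   (- (bern_poly k (1 - x) - (-1) ^ k * bern_poly k x)).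
Proof.
  replace (- (bern_poly k (1 - x) - (-1) ^ k * bern_poly k x))
    with (-1 * bern_poly k (1 - x) - (-1) ^ S k * bern_poly k x) by (simpl; ring).
  apply (is_derive_minus (V := R_NormedModule));
    [|apply is_derive_scal, is_derive_bern_poly].
  apply (is_derive_comp (V := R_NormedModule) (bern_poly (S k)));
    [apply is_derive_bern_poly|auto_derive; [trivial|ring]].
Qed.

(* If the defect of the symmetry vanishes in degree k, it is a constant in degree k+1; the defect
   in degree k+2 is then linear with equal values at 0 and 1, so that constant is 0. *)
Lemma bern_poly_reflect (k : nat) (x : R) : bern_poly k (1 - x) = (-1) ^ k * bern_poly k x.
Proof.
  apply Rminus_diag_uniq; revert x; induction k as [|[|k] IH]; intros x.
  - rewrite !bern_poly_deg0; simpl; ring.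
  - rewrite !bern_poly_deg1; simpl; field.
  - set (q := fun j x => bern_poly j (1 - x) - (-1) ^ j * bern_poly j x) in *.
    change (q (S (S k)) x = 0).
    assert (Hconst : forall y z, q (S (S k)) y = q (S (S k)) z).
    { apply is_derive_0_const; intros y; rewrite <- Ropp_0, <- (IH y).
      apply is_derive_bern_poly_reflect. }
    destruct (MVT_gen (q (S (S (S k)))) 0 1 (fun y => - q (S (S k)) y)) as [c [_ Hc]].
    + intros; apply is_derive_bern_poly_reflect.
    + intros; apply continuity_pt_filterlim, (ex_derive_continuous (V := R_NormedModule)).
      eexists; apply is_derive_bern_poly_reflect.
    + unfold q at 1 2 in Hc; rewrite !Rminus_diag, !Rminus_0_r in Hc.
      rewrite !bern_poly_at_0, !bern_poly_at_1, (Hconst c x) in Hc by lia; lra.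
Qed.

Lemma bern_odd (k : nat) : bern (2 * k + 3) = 0.
Proof.
  pose proof (bern_poly_reflect (2 * k + 3) 0) as H.
  rewrite Rminus_0_r, bern_poly_at_0, bern_poly_at_1 in H by lia.
  replace (2 * k + 3)%nat with (S (2 * (S k)))%nat in * by lia.
  rewrite pow_1_odd in H; lra.
Qed.

Lemma bern_poly_odd_at_half (k : nat) : bern_poly (2 * k + 1) (1 / 2) = 0.
Proof.
  pose proof (bern_poly_reflect (2 * k + 1) (1 / 2)) as H.
  replace (1 - 1 / 2) with (1 / 2) in H by field.
  rewrite Nat.add_1_r, pow_1_odd, <- Nat.add_1_r in H; lra.
Qed.

Lemma bern_poly_MVT (k : nat) (a b : R) : a < b ->
  exists c, a < c < b /\ bern_poly (S k) b - bern_poly (S k) a = bern_poly k c * (b - a).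
Proof.
  intros Hab.
  destruct (MVT_cor2 (bern_poly (S k)) (bern_poly k) a b Hab) as [c [Hc Hin]].
  - intros c _; apply is_derive_Reals, is_derive_bern_poly.
  - now exists c.
Qed.

(* [bern_poly (2k+3)] vanishes at 0 and 1/2 and has second derivative [bern_poly (2k+1)], so the
   sign of one determines that of the other by convexity. *)
Lemma bern_poly_odd_sign (k : nat) (x : R) : 0 < x < 1 / 2 ->
  0 < (-1) ^ S k * bern_poly (2 * k + 1) x.
Proof.
  revert x; induction k as [|k IH]; intros x Hx; [simpl; rewrite bern_poly_deg1; lra|].
  assert (Hzero : bern_poly (2 * S k + 1) 0 = 0).
  { rewrite bern_poly_at_0; replace (2 * S k + 1)%nat with (2 * k + 3)%nat by lia.
    apply bern_odd. }
  pose proof (bern_poly_odd_at_half (S k)) as Hhalf.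
  replace (2 * S k + 1)%nat with (S (S (2 * k + 1))) in * by lia.
  destruct (bern_poly_MVT (S (2 * k + 1)) 0 x) as [c1 [Hc1 Hslope1]]; [lra|].
  destruct (bern_poly_MVT (S (2 * k + 1)) x (1 / 2)) as [c2 [Hc2 Hslope2]]; [lra|].
  destruct (bern_poly_MVT (2 * k + 1) c1 c2) as [c3 [Hc3 Hslope3]]; [lra|].
  specialize (IH c3 ltac:(lra)); rewrite Hzero in Hslope1; rewrite Hhalf in Hslope2.
  set (px := bern_poly (S (S (2 * k + 1))) x) in *.
  set (q1 := bern_poly (S (2 * k + 1)) c1) in *; set (q2 := bern_poly (S (2 * k + 1)) c2) in *.
  set (r := bern_poly (2 * k + 1) c3) in *.
  change ((-1) ^ S (S k)) with (-1 * (-1) ^ S k); set (sgn := (-1) ^ S k) in *.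
  apply Rnot_le_lt; intros Hle.
  assert (Hq1 : 0 <= sgn * q1) by (assert (0 <= sgn * q1 * x) by nra; nra).
  assert (Hq2 : sgn * q2 <= 0) by (assert (sgn * q2 * (1 / 2 - x) <= 0) by nra; nra).
  assert (Hr : 0 < sgn * r * (c2 - c1)) by (apply Rmult_lt_0_compat; lra).
  nra.
Qed.

Lemma bern_even_neq_0 (k : nat) : bern (2 * k + 2) <> 0.
Proof.
  intros Heven.
  destruct (bern_poly_MVT (2 * k + 2) 0 (1 / 2)) as [c [Hc Hslope]]; [lra|].
  destruct (bern_poly_MVT (2 * k + 1) 0 c) as [c' [Hc' Hslope']]; [lra|].
  replace (S (2 * k + 2)) with (2 * k + 3)%nat in Hslope by lia.
  replace (S (2 * k + 1)) with (2 * k + 2)%nat in Hslope' by lia.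
  rewrite bern_poly_at_0, bern_odd in Hslope; rewrite bern_poly_at_0, Heven in Hslope'.
  replace (2 * k + 3)%nat with (2 * S k + 1)%nat in Hslope by lia.
  rewrite bern_poly_odd_at_half in Hslope.
  assert (Hc0 : bern_poly (2 * k + 2) c = 0) by nra; rewrite Hc0 in Hslope'.
  assert (Hc'0 : bern_poly (2 * k + 1) c' = 0) by nra.
  pose proof (bern_poly_odd_sign k c' ltac:(lra)) as Hsign; rewrite Hc'0 in Hsign; lra.
Qed.

Lemma power_sum_bern_poly (n N : nat) :
  sum_f_R0 (fun m => INR m ^ n) N = INR (fact n) * (bern_poly (S n) (INR N + 1) - bern (S n)).
Proof.
  assert (Hshift : forall x,
    x ^ n = INR (fact n) * (bern_poly (S n) (x + 1) - bern_poly (S n) x)).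
  { intros x; rewrite bern_poly_shift; field; apply INR_fact_neq_0. }
  induction N as [|N IH].
  - simpl sum_f_R0; simpl INR; now rewrite Hshift, bern_poly_at_0.
  - rewrite tech5, IH, Hshift, S_INR; ring.
Qed.

(** * Series of complex numbers *)

#[local] Notation is_Cseries := (is_series (K := C_AbsRing) (V := C_NormedModule)).
#[local] Notation ex_Cseries := (ex_series (K := C_AbsRing) (V := C_NormedModule)).

(* Goals produced by Coquelicot's generic lemmas carry equality at a structure sort, which [ring]
   and [field] do not recognise. *)
Ltac eq_in_C := match goal with |- @eq _ ?a ?b => change (@eq C a b) end.

Lemma is_Cseries_iff (u : nat -> C) (l : C) :
  is_Cseries u l <-> is_lim_seq (fun n => Cmod (sum_n u n - l)) 0.
Proof.
  split; intros H.
  - apply is_lim_seq_spec; intros eps.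
    apply (proj1 (filterlim_locally_ball_norm (U := C_NormedModule) _ l)) with (eps := eps) in H.
    revert H; apply filter_imp; intros n Hn.
    rewrite Rminus_0_r, Rabs_pos_eq by apply Cmod_ge_0; exact Hn.
  - apply (filterlim_locally_ball_norm (U := C_NormedModule)); intros eps.
    generalize (proj2 (is_lim_seq_spec _ _) H eps); apply filter_imp; intros n Hn.
    rewrite Rminus_0_r, Rabs_pos_eq in Hn by apply Cmod_ge_0; exact Hn.
Qed.

Lemma is_Cseries_Re (u : nat -> C) (l : C) :
  is_Cseries u l -> is_series (fun k => Re (u k)) (Re l).
Proof.
  intros H; apply (filterlim_ext (fun n => Re (sum_n u n))).
  { induction x as [|n IH]; [now rewrite !sum_O|rewrite !sum_Sn, <- IH; apply re_plus]. }
  apply (filterlim_comp _ _ _ (fun n => sum_n u n) Re _ (locally l)); [exact H|].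
  destruct l; apply continuous_fst.
Qed.

Lemma is_Cseries_Im (u : nat -> C) (l : C) :
  is_Cseries u l -> is_series (fun k => Im (u k)) (Im l).
Proof.
  intros H; apply (filterlim_ext (fun n => Im (sum_n u n))).
  { induction x as [|n IH]; [now rewrite !sum_O|rewrite !sum_Sn, <- IH; apply im_plus]. }
  apply (filterlim_comp _ _ _ (fun n => sum_n u n) Im _ (locally l)); [exact H|].
  destruct l; apply continuous_snd.
Qed.

Definition Cseries (u : nat -> C) : C := (Series (fun k => Re (u k)), Series (fun k => Im (u k))).

Lemma is_Cseries_unique (u : nat -> C) (l : C) : is_Cseries u l -> Cseries u = l.
Proof.
  intros H; apply injective_projections; apply is_series_unique;
    [now apply is_Cseries_Re|now apply is_Cseries_Im].
Qed.

Lemma Cseries_correct (u : nat -> C) : ex_Cseries u -> is_Cseries u (Cseries u).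
Proof. intros [l Hl]; now rewrite (is_Cseries_unique u l Hl). Qed.

Lemma ex_Cseries_le (u : nat -> C) (a : nat -> R) :
  (forall k, Cmod (u k) <= a k) -> ex_series a -> ex_Cseries u.
Proof. apply (ex_series_le (K := C_AbsRing) (V := C_CompleteNormedModule)). Qed.

Lemma is_Cseries_plus (u v : nat -> C) (l m : C) :
  is_Cseries u l -> is_Cseries v m -> is_Cseries (fun n => u n + v n)%C (l + m)%C.
Proof. apply (is_series_plus (V := C_NormedModule)). Qed.

Lemma is_Cseries_minus (u v : nat -> C) (l m : C) :
  is_Cseries u l -> is_Cseries v m -> is_Cseries (fun n => u n - v n)%C (l - m)%C.
Proof. apply (is_series_minus (V := C_NormedModule)). Qed.

Lemma is_Cseries_mult_l (c : C) (u : nat -> C) (l : C) :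
  is_Cseries u l -> is_Cseries (fun n => c * u n)%C (c * l)%C.
Proof. apply (is_series_scal (V := C_NormedModule) c). Qed.

Lemma is_Cseries_mult_r (c : C) (u : nat -> C) (l : C) :
  is_Cseries u l -> is_Cseries (fun n => u n * c)%C (l * c)%C.
Proof.
  intros H; rewrite Cmult_comm; apply (is_series_ext (V := C_NormedModule) (fun n => c * u n)%C).
  - intros n; apply Cmult_comm.
  - now apply is_Cseries_mult_l.
Qed.

Lemma is_Cseries_sum_n (u : nat -> nat -> C) (l : nat -> C) (L : nat) :
  (forall j, (j <= L)%nat -> is_Cseries (u j) (l j)) ->
  is_Cseries (fun k => sum_n (fun j => u j k) L) (sum_n l L).
Proof.
  induction L as [|L IH]; intros H.
  - rewrite sum_O; apply (is_series_ext (V := C_NormedModule) (u 0%nat)); [|now apply H].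
    intros k; now rewrite sum_O.
  - rewrite sum_Sn.
    apply (is_series_ext (V := C_NormedModule)
      (fun k => plus (sum_n (fun j => u j k) L) (u (S L) k))).
    { intros k; now rewrite sum_Sn. }
    apply is_Cseries_plus; [apply IH; auto|now apply H].
Qed.

Lemma Cmod_sum_n_le (u : nat -> C) (a : nat -> R) (n : nat) :
  (forall k, Cmod (u k) <= a k) -> Cmod (sum_n u n) <= sum_n a n.
Proof.
  intros H; induction n as [|n IH]; [rewrite !sum_O; apply H|].
  rewrite !sum_Sn; apply Rle_trans with (1 := Cmod_triangle _ _).
  now apply Rplus_le_compat.
Qed.

Lemma Cmod_is_Cseries_le (u : nat -> C) (a : nat -> R) (l : C) :
  is_Cseries u l -> (forall k, Cmod (u k) <= a k) -> ex_series a -> Cmod l <= Series a.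
Proof.
  intros Hu Ha Hex; apply is_Cseries_iff in Hu.
  assert (Hlim : is_lim_seq (fun n => sum_n a n + Cmod (sum_n u n - l)) (Series a + 0))
    by (apply is_lim_seq_plus'; [now apply Series_correct|exact Hu]).
  rewrite Rplus_0_r in Hlim.
  apply (is_lim_seq_le (fun _ => Cmod l) _ (Cmod l) _) in Hlim;
    [exact Hlim| |apply is_lim_seq_const].
  intros n; pose proof (Cmod_sum_n_le u a n Ha).
  pose proof (Cmod_minus_le (sum_n u n) (sum_n u n - l)) as Htri.
  replace (sum_n u n - (sum_n u n - l))%C with l in Htri by ring; lra.
Qed.

Lemma is_Cseries_telescope (u : nat -> C) :
  is_lim_seq (fun n => Cmod (u n)) 0 -> is_Cseries (fun n => u n - u (S n))%C (u 0%nat).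
Proof.
  intros Hu; apply is_Cseries_iff, (is_lim_seq_ext (fun n => Cmod (u (S n)))).
  - intros n; replace (sum_n (fun n => u n - u (S n))%C n - u 0%nat)%C with (- u (S n))%C;
      [now rewrite Cmod_opp|].
    induction n as [|n IH]; [rewrite sum_O; ring|].
    rewrite sum_Sn; change plus with Cplus.
    replace (- u (S (S n)))%C with (- u (S n) + (u (S n) - u (S (S n))))%C by ring.
    rewrite IH; ring.
  - now apply (is_lim_seq_incr_1 (fun n => Cmod (u n))).
Qed.

Lemma holo_at_Cseries (J : nat -> C -> C) (J' : nat -> C) (a : nat -> R) (z : C) (d : R) :
  0 < d -> ex_series a -> (forall k, Cmod (J' k) <= a k) ->
  (forall k h, Cmod h < d -> Cmod (J k (z + h)%C) <= a k) ->
  (forall k h, Cmod h < d -> Cmod (J k (z + h)%C - J k z - J' k * h) <= a k * Cmod h ^ 2) ->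
  holo_at (fun z => Cseries (fun k => J k z)) z.
Proof.
  intros Hd Ha HJ' HJ Hrem.
  assert (Hsum : forall h, Cmod h < d ->
    is_Cseries (fun k => J k (z + h)%C) (Cseries (fun k => J k (z + h)%C))).
  { intros h Hh; apply Cseries_correct, ex_Cseries_le with a; [intros k; now apply HJ|exact Ha]. }
  assert (Hsum0 := Hsum 0 ltac:(rewrite Cmod_0; exact Hd)); rewrite Cplus_0_r in Hsum0.
  assert (Hsum' : is_Cseries J' (Cseries J')) by now apply Cseries_correct, ex_Cseries_le with a.
  apply (holo_at_quadratic_remainder _ z (Cseries J') (Series a) d Hd); intros h Hh.
  rewrite <- Series_scal_r.
  apply (Cmod_is_Cseries_le (fun k => J k (z + h)%C - J k z - J' k * h)%C).
  - apply is_Cseries_minus; [|now apply is_Cseries_mult_r].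
    apply is_Cseries_minus; [now apply Hsum|exact Hsum0].
  - intros k; now apply Hrem.
  - now apply ex_series_scal_r.
Qed.

(** * Euler-Maclaurin summation *)

Lemma is_lim_seq_power_decay (e : R) : 0 < e ->
  is_lim_seq (fun n => exp (- e * ln (INR n + 1))) 0.
Proof.
  intros He; apply (is_lim_comp_seq (fun y => exp (- e * y)) _ p_infty 0).
  - apply (is_lim_comp exp (fun y => - e * y) p_infty 0 m_infty); [apply is_lim_exp_m| |].
    + replace m_infty with (Rbar_mult (- e) p_infty)
        by (apply is_Rbar_mult_unique, is_Rbar_mult_sym, is_Rbar_mult_p_infty_neg; simpl; lra).
      apply is_lim_scal_l, is_lim_id.
    + exists 0; discriminate.
  - exists 0%nat; discriminate.
  - apply (is_lim_comp_seq ln _ p_infty p_infty is_lim_ln_p); [exists 0%nat; discriminate|].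
    apply (is_lim_seq_ext (fun n => INR (S n))); [intros n; apply S_INR|].
    apply (proj1 (is_lim_seq_incr_1 INR p_infty)), is_lim_seq_INR.
Qed.

Lemma is_Cseries_cpow_telescope (w : C) : 0 < Re w ->
  is_Cseries (fun n => cpow (INR n + 1) (- w) - cpow (INR n + 2) (- w))%C (RtoC 1).
Proof.
  intros Hw; replace (RtoC 1) with (cpow (INR 0 + 1) (- w))
    by (simpl; rewrite Rplus_0_l; apply cpow_1_l).
  apply (is_series_ext (V := C_NormedModule)
    (fun n => cpow (INR n + 1) (- w) - cpow (INR (S n) + 1) (- w))%C).
  { intros n; rewrite S_INR; now replace (INR n + 1 + 1) with (INR n + 2) by ring. }
  apply (is_Cseries_telescope (fun n => cpow (INR n + 1) (- w))).
  apply (is_lim_seq_ext (fun n => exp (- Re w * ln (INR n + 1)))).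
  - intros n; now rewrite Cmod_cpow, re_opp.
  - now apply is_lim_seq_power_decay.
Qed.

Lemma power_decay_le (e x : R) : 0 < e -> 1 <= x ->
  exp (- (1 + e) * ln (x + 1)) <= (exp (- e * ln x) - exp (- e * ln (x + 1))) / e.
Proof.
  intros He Hx.
  destruct (MVT_cor2 (fun x => - exp (- e * ln x) / e) (fun x => exp (- (1 + e) * ln x)) x (x + 1))
    as [c [Hc Hin]]; [lra| |].
  - intros c Hc; apply is_derive_Reals; auto_derive; [lra|].
    replace (- (1 + e) * ln c) with (- e * ln c + - ln c) by ring.
    rewrite exp_plus, exp_Ropp, exp_ln by lra; field; lra.
  - assert (exp (- (1 + e) * ln (x + 1)) <= exp (- (1 + e) * ln c))
      by (apply exp_le; pose proof (ln_le c (x + 1)); nra).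
    unfold Rdiv in *; lra.
Qed.

Lemma ex_series_power_decay (e : R) : 0 < e ->
  ex_series (fun n => exp (- (1 + e) * ln (INR n + 1))).
Proof.
  intros He; apply ex_series_incr_1.
  apply (ex_series_le (V := R_CompleteNormedModule) _
    (fun n => (exp (- e * ln (INR n + 1)) - exp (- e * ln (INR n + 2))) * / e)).
  - intros n; pose proof (pos_INR n); rewrite S_INR.
    change (norm _) with (Rabs (exp (- (1 + e) * ln (INR n + 1 + 1)))).
    rewrite Rabs_pos_eq by (left; apply exp_pos).
    replace (INR n + 2) with (INR n + 1 + 1) by ring; apply power_decay_le; lra.
  - apply ex_series_scal_r; exists 1.
    apply (is_series_ext (fun n => Re (cpow (INR n + 1) (- e) - cpow (INR n + 2) (- e)))).
    { intros n; rewrite <- RtoC_opp, !cpow_RtoC, <- RtoC_minus; apply re_RtoC. }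
    apply (is_Cseries_Re _ 1), is_Cseries_cpow_telescope; rewrite re_RtoC; exact He.
Qed.

Lemma ln_le_power (eta x : R) : 0 < eta -> ln x <= exp (eta * ln x) / eta.
Proof.
  intros He; apply Rle_div_r; [exact He|].
  pose proof (exp_ineq1_le (eta * ln x)); lra.
Qed.

Definition power_majorant (eta x : R) : R :=
  (1 + 1 / eta + 1 / eta ^ 2) * exp (- (1 + eta) * ln x).

Lemma exp_ln_le_power_majorant (eta x y c r : R) : 0 < eta -> 1 <= x <= y ->
  0 <= c <= 1 + 1 / eta + 1 / eta ^ 2 -> r <= - (1 + eta) ->
  c * exp (r * ln y) <= power_majorant eta x.
Proof.
  intros Heta Hxy Hc Hr; pose proof (ln_nonneg x); pose proof (ln_le x y).
  apply Rmult_le_compat; [lra|left; apply exp_pos|lra|apply exp_le; nra].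
Qed.

(* The margin [4 eta] pays for the displacement [h] and for two factors [ln y <= y^eta / eta], and
   leaves the summable exponent [1 + eta]. *)
Lemma cpow_derivatives_le (eta x y : R) (z h : C) : 0 < eta -> 1 <= x <= y ->
  Re z <= - (1 + 4 * eta) -> Cmod h < eta ->
  Cmod (cpow y (z + h)) <= power_majorant eta x /\
  Cmod (ln y * cpow y z) <= power_majorant eta x /\
  Cmod (cpow y (z + h) - cpow y z - ln y * cpow y z * h) <= power_majorant eta x * Cmod h ^ 2.
Proof.
  intros Heta Hxy Hz Hh; assert (Hln : 0 <= ln y) by (apply ln_nonneg; lra).
  pose proof (ln_le_power eta y Heta) as Hln_le.
  assert (Hinv1 : 0 < 1 / eta) by (apply Rdiv_lt_0_compat; lra).
  assert (Hinv2 : 0 < 1 / eta ^ 2) by (apply Rdiv_lt_0_compat; [|apply pow_lt]; lra).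
  pose proof (Cmod_ge_0 h); pose proof (re_le_Cmod h) as Hreh; apply Rabs_le_between in Hreh.
  repeat split.
  - rewrite Cmod_cpow, re_plus, <- (Rmult_1_l (exp _)); apply exp_ln_le_power_majorant; lra.
  - rewrite Cmod_mult, Cmod_R, Cmod_cpow, Rabs_pos_eq by exact Hln.
    apply Rle_trans with (exp (eta * ln y) / eta * exp (Re z * ln y)).
    { apply Rmult_le_compat_r; [left; apply exp_pos|exact Hln_le]. }
    replace (exp (eta * ln y) / eta * exp (Re z * ln y)) with (1 / eta * exp ((eta + Re z) * ln y))
      by (rewrite Rmult_plus_distr_r, exp_plus; field; lra).
    apply exp_ln_le_power_majorant; lra.
  - apply Rle_trans with (1 := cpow_remainder y z h ltac:(lra)).
    apply Rmult_le_compat_r; [apply pow2_ge_0|].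
    apply Rle_trans with (exp ((Re z + Cmod h) * ln y) * (exp (eta * ln y) / eta) ^ 2).
    { apply Rmult_le_compat_l; [left; apply exp_pos|apply pow_incr; lra]. }
    replace (exp ((Re z + Cmod h) * ln y) * (exp (eta * ln y) / eta) ^ 2)
      with (1 / eta ^ 2 * exp ((Re z + Cmod h + (eta + eta)) * ln y))
      by (rewrite (Rmult_plus_distr_r (Re z + Cmod h)), (Rmult_plus_distr_r eta), !exp_plus;
          field; lra).
    apply exp_ln_le_power_majorant; lra.
Qed.

Definition power_integral (p : R -> R) (n : nat) (z : C) : C :=
  CInt (fun t => p t * cpow (INR n + 1 + t) z)%C 0 1.

Definition power_ln_integral (p : R -> R) (n : nat) (z : C) : C :=
  CInt (fun t => p t * (ln (INR n + 1 + t) * cpow (INR n + 1 + t) z))%C 0 1.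

Lemma is_CInt_power_integral (p : R -> R) (n : nat) (z : C) : (forall t, continuous p t) ->
  is_CInt (fun t => p t * cpow (INR n + 1 + t) z)%C 0 1 (power_integral p n z).
Proof.
  intros Hp; apply CInt_correct, ex_CInt_Ccontinuous; [lra|]; intros t Ht; pose proof (pos_INR n).
  apply Ccontinuous_Rmult; [apply Hp|apply Ccontinuous_cpow; lra].
Qed.

Lemma is_CInt_power_ln_integral (p : R -> R) (n : nat) (z : C) : (forall t, continuous p t) ->
  is_CInt (fun t => p t * (ln (INR n + 1 + t) * cpow (INR n + 1 + t) z))%C 0 1
    (power_ln_integral p n z).
Proof.
  intros Hp; apply CInt_correct, ex_CInt_Ccontinuous; [lra|]; intros t Ht; pose proof (pos_INR n).
  apply Ccontinuous_Rmult; [apply Hp|].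
  apply (Ccontinuous_Rmult (fun t => ln (INR n + 1 + t))); [|apply Ccontinuous_cpow; lra].
  apply (ex_derive_continuous (V := R_NormedModule)); auto_derive; lra.
Qed.

Lemma Cmod_weighted_CInt_le (p : R -> R) (f : R -> C) (l : C) (B M : R) :
  is_CInt (fun t => p t * f t)%C 0 1 l -> (forall t, 0 <= t <= 1 -> Rabs (p t) <= B) ->
  (forall t, 0 <= t <= 1 -> Cmod (f t) <= M) -> Cmod l <= B * M.
Proof.
  intros Hf HB HM; replace (B * M) with ((1 - 0) * (B * M)) by ring.
  apply (Cmod_is_CInt_le (fun t => p t * f t)%C); [lra|exact Hf|].
  intros t Ht; rewrite Cmod_mult, Cmod_R.
  apply Rmult_le_compat; auto using Rabs_pos, Cmod_ge_0.
Qed.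

Lemma power_integral_derivatives_le (p : R -> R) (B eta : R) (n : nat) (z h : C) :
  (forall t, continuous p t) -> (forall t, 0 <= t <= 1 -> Rabs (p t) <= B) ->
  0 < eta -> Re z <= - (1 + 4 * eta) -> Cmod h < eta ->
  Cmod (power_integral p n (z + h)) <= B * power_majorant eta (INR n + 1) /\
  Cmod (power_ln_integral p n z) <= B * power_majorant eta (INR n + 1) /\
  Cmod (power_integral p n (z + h) - power_integral p n z - power_ln_integral p n z * h)
    <= B * power_majorant eta (INR n + 1) * Cmod h ^ 2.
Proof.
  intros Hp HB Heta Hz Hh; pose proof (pos_INR n).
  assert (Hle := fun t (Ht : 0 <= t <= 1) => cpow_derivatives_le eta (INR n + 1) (INR n + 1 + t) z h
    Heta ltac:(lra) Hz Hh).
  repeat split.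
  - apply Cmod_weighted_CInt_le with (2 := HB) (1 := is_CInt_power_integral p n (z + h) Hp).
    intros t Ht; now apply Hle.
  - apply Cmod_weighted_CInt_le with (2 := HB) (1 := is_CInt_power_ln_integral p n z Hp).
    intros t Ht; now apply Hle.
  - rewrite Rmult_assoc; apply (Cmod_weighted_CInt_le p (fun t => cpow (INR n + 1 + t) (z + h)
      - cpow (INR n + 1 + t) z - ln (INR n + 1 + t) * cpow (INR n + 1 + t) z * h)%C);
      [|exact HB|intros t Ht; now apply Hle].
    apply (is_RInt_ext (V := C_R_NormedModule) (fun t => p t * cpow (INR n + 1 + t) (z + h)
      - p t * cpow (INR n + 1 + t) z
      - p t * (ln (INR n + 1 + t) * cpow (INR n + 1 + t) z) * h)%C).
    { intros t _; eq_in_C; ring. }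
    apply is_CInt_minus; [|now apply is_CInt_mult_r, is_CInt_power_ln_integral].
    now apply is_CInt_minus; apply is_CInt_power_integral.
Qed.

Lemma ex_series_power_majorant (c eta : R) : 0 < eta ->
  ex_series (fun n => c * power_majorant eta (INR n + 1)).
Proof.
  intros Heta; apply (ex_series_scal_l (K := R_AbsRing) (V := R_NormedModule) c).
  apply (ex_series_scal_l (K := R_AbsRing) (V := R_NormedModule)); now apply ex_series_power_decay.
Qed.

Section PowerIntegralSeries.

Variables (p : R -> R) (z : C).
Hypothesis p_cont : forall t, continuous p t.
Hypothesis z_left : Re z < -1.

Let eta : R := (-1 - Re z) / 4.

Lemma ex_Cseries_power_integral : ex_Cseries (fun n => power_integral p n z).
Proof.
  destruct (continuous_norm_bounded p 0 1) as [B [_ HB]]; [lra|auto|].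
  assert (Heta : 0 < eta) by (unfold eta; lra).
  apply ex_Cseries_le with (fun n => B * power_majorant eta (INR n + 1));
    [|now apply ex_series_power_majorant].
  intros n; rewrite <- (Cplus_0_r z).
  apply (power_integral_derivatives_le p B eta n z 0); auto; [unfold eta; lra|now rewrite Cmod_0].
Qed.

Theorem holo_at_Cseries_power_integral :
  holo_at (fun z => Cseries (fun n => power_integral p n z)) z.
Proof.
  destruct (continuous_norm_bounded p 0 1) as [B [_ HB]]; [lra|auto|].
  assert (Heta : 0 < eta) by (unfold eta; lra).
  assert (Hle := fun n h => power_integral_derivatives_le p B eta n z h p_cont HB Heta
    ltac:(unfold eta; lra)).
  assert (Hzero : Cmod 0 < eta) by now rewrite Cmod_0.
  apply (holo_at_Cseries (power_integral p) (fun n => power_ln_integral p n z)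
    (fun n => B * power_majorant eta (INR n + 1)) z eta Heta);
    [now apply ex_series_power_majorant| | |].
  - intros n; destruct (Hle n 0 Hzero) as [_ [H _]]; exact H.
  - intros n h Hh; destruct (Hle n h Hh) as [H _]; exact H.
  - intros n h Hh; destruct (Hle n h Hh) as [_ [_ H]]; exact H.
Qed.

End PowerIntegralSeries.

Lemma is_Cderive_Rmult (p : R -> R) (f : R -> C) (dp : R) (df : C) (t : R) :
  is_derive p t dp -> is_Cderive f t df ->
  is_Cderive (fun t => RtoC (p t) * f t)%C t (dp * f t + p t * df)%C.
Proof.
  intros Hp Hf; apply (is_derive_ext (V := C_R_NormedModule) (fun t => scal (p t) (f t))).
  { intros u; apply scal_R_Cmult. }
  pose proof (filterdiff_scal_fct (K := R_AbsRing) (U := AbsRing_NormedModule R_AbsRing)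
    (V := C_R_NormedModule) t p f _ _ Rmult_comm Hp Hf) as H.
  apply (filterdiff_ext_lin _ _ _ H); intros y.
  change (scal y dp) with (y * dp); change plus with Cplus; rewrite !scal_R_Cmult, RtoC_mult.
  eq_in_C; ring.
Qed.

Lemma power_integral_parts (P p : R -> R) (n : nat) (z : C) :
  (forall t, is_derive P t (p t)) -> (forall t, continuous p t) ->
  power_integral p n z
  = (P 1 * cpow (INR n + 2) z - P 0 * cpow (INR n + 1) z - power_integral P n (z - 1) * z)%C.
Proof.
  intros HP Hp; pose proof (pos_INR n).
  assert (HPcont : forall t, continuous P t)
    by (intros t; apply (ex_derive_continuous (V := R_NormedModule)); eexists; apply HP).
  set (F := fun t => (P t * cpow (INR n + 1 + t) z)%C).
  set (dF := fun t => (p t * cpow (INR n + 1 + t) z + P t * (z * cpow (INR n + 1 + t) (z - 1)))%C).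
  assert (Hboundary : is_CInt dF 0 1 (F 1 - F 0)%C).
  { apply is_CInt_derive; [lra| |]; intros t Ht.
    - apply is_Cderive_Rmult; [apply HP|apply is_Cderive_cpow; lra].
    - apply (continuous_plus (V := C_R_NormedModule)); apply Ccontinuous_Rmult;
        [apply Hp|apply Ccontinuous_cpow; lra|apply HPcont|].
      apply (holo_at_Ccontinuous (fun w => z * w)%C);
        [auto with holo|apply Ccontinuous_cpow; lra]. }
  assert (Hsum : is_CInt dF 0 1 (power_integral p n z + power_integral P n (z - 1) * z)%C).
  { apply (is_RInt_ext (V := C_R_NormedModule) (fun t =>
      p t * cpow (INR n + 1 + t) z + P t * cpow (INR n + 1 + t) (z - 1) * z)%C).
    { intros t _; unfold dF; eq_in_C; ring. }
    apply is_CInt_plus; [now apply is_CInt_power_integral|].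
    now apply is_CInt_mult_r, is_CInt_power_integral. }
  apply is_CInt_unique in Hboundary; apply is_CInt_unique in Hsum; rewrite Hboundary in Hsum.
  unfold F in Hsum; rewrite Rplus_0_r in Hsum.
  replace (INR n + 1 + 1) with (INR n + 2) in Hsum by ring.
  rewrite Hsum; eq_in_C; ring.
Qed.

Lemma power_integral_1 (s : C) (n : nat) : s <> 1 ->
  power_integral (fun _ => 1) n (- s)
  = ((cpow (INR n + 1) (- (s - 1)) - cpow (INR n + 2) (- (s - 1))) * / (s - 1))%C.
Proof.
  intros Hs; pose proof (pos_INR n); assert (Hs1 := Cminus_eq_contra _ _ Hs).
  unfold power_integral.
  set (z := (- (s - 1))%C); assert (Hz : (z - 1 = - s)%C) by (unfold z; ring).
  assert (Hprim : is_CInt (fun t => z * cpow (INR n + 1 + t) (z - 1))%C 0 1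
    (cpow (INR n + 1 + 1) z - cpow (INR n + 1 + 0) z)%C).
  { apply (is_CInt_derive (fun t => cpow (INR n + 1 + t) z)); [lra| |]; intros t Ht.
    - apply is_Cderive_cpow; lra.
    - apply (holo_at_Ccontinuous (fun w => z * w)%C);
        [auto with holo|apply Ccontinuous_cpow; lra]. }
  apply (is_CInt_mult_r _ _ _ (/ z)) in Hprim.
  rewrite Rplus_0_r in Hprim; replace (INR n + 1 + 1) with (INR n + 2) in Hprim by ring.
  rewrite Hz in Hprim.
  assert (Hz0 : z <> 0) by (intros Hz0; apply Hs1; rewrite <- (Copp_0), <- Hz0; unfold z; ring).
  apply is_CInt_unique.
  replace ((cpow (INR n + 1) z - cpow (INR n + 2) z) * / (s - 1))%C
    with ((cpow (INR n + 2) z - cpow (INR n + 1) z) * / z)%C by (unfold z in *; field; auto).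
  revert Hprim; apply (is_RInt_ext (V := C_R_NormedModule)); intros t _; eq_in_C; field; exact Hz0.
Qed.

Fixpoint rising_factorial (s : C) (k : nat) : C :=
  match k with O => 1 | S k' => (rising_factorial s k' * (s + INR k'))%C end.

Fixpoint euler_maclaurin_sum (s : C) (m : nat) : C :=
  match m with
  | O => 0
  | S m' => (euler_maclaurin_sum s m' + rising_factorial s (S m') * bern (S (S m')))%C
  end.

Definition euler_maclaurin_remainder (k : nat) (s : C) : C :=
  Cseries (fun n => power_integral (bern_poly k) n (- (s + INR k))).

Lemma ex_Cseries_euler_maclaurin (k : nat) (s : C) : 1 < Re s + INR k ->
  ex_Cseries (fun n => power_integral (bern_poly k) n (- (s + INR k))).
Proof.
  intros Hs; apply ex_Cseries_power_integral; [apply continuous_bern_poly|].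
  rewrite re_opp, re_plus, re_RtoC; lra.
Qed.

Lemma euler_maclaurin_remainder_S (k : nat) (s : C) : (1 <= k)%nat -> 1 < Re s + INR k ->
  euler_maclaurin_remainder k s
  = ((s + INR k) * euler_maclaurin_remainder (S k) s - bern (S k))%C.
Proof.
  intros Hk Hs; set (w := (s + INR k)%C).
  assert (Hw : 1 < Re w) by (unfold w; now rewrite re_plus, re_RtoC).
  apply is_Cseries_unique.
  apply (is_series_ext (V := C_NormedModule) (fun n =>
    w * power_integral (bern_poly (S k)) n (- (s + INR (S k)))
    - bern (S k) * (cpow (INR n + 1) (- w) - cpow (INR n + 2) (- w)))%C).
  - intros n; rewrite (power_integral_parts (bern_poly (S k)) (bern_poly k));
      [|apply is_derive_bern_poly|apply continuous_bern_poly].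
    rewrite bern_poly_at_1, bern_poly_at_0, S_INR, RtoC_plus by lia.
    replace (- (s + (INR k + 1)))%C with (- w - 1)%C by (unfold w; ring).
    fold w; eq_in_C; ring.
  - replace (w * euler_maclaurin_remainder (S k) s - bern (S k))%C
      with (w * euler_maclaurin_remainder (S k) s - bern (S k) * 1)%C by (eq_in_C; ring).
    apply is_Cseries_minus; apply is_Cseries_mult_l.
    + apply Cseries_correct, ex_Cseries_euler_maclaurin; rewrite S_INR; lra.
    + apply is_Cseries_cpow_telescope; lra.
Qed.

(* The Euler-Maclaurin expression for zeta(s) - 1/(s-1), convergent for Re s > -m. *)
Definition zeta_regular_part (m : nat) (s : C) : C :=
  (1 / 2 + euler_maclaurin_sum s m
   - rising_factorial s (S m) * euler_maclaurin_remainder (S m) s)%C.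

Lemma zeta_regular_part_S (m : nat) (s : C) : - INR m < Re s ->
  zeta_regular_part (S m) s = zeta_regular_part m s.
Proof.
  intros Hs; unfold zeta_regular_part.
  rewrite (euler_maclaurin_remainder_S (S m)) by (lia || (rewrite S_INR; lra)).
  change (rising_factorial s (S (S m))) with (rising_factorial s (S m) * (s + INR (S m)))%C.
  change (euler_maclaurin_sum s (S m))
    with (euler_maclaurin_sum s m + rising_factorial s (S m) * bern (S (S m)))%C.
  ring.
Qed.

Lemma holo_at_rising_factorial (k : nat) (z : C) : holo_at (fun s => rising_factorial s k) z.
Proof. induction k as [|k IH]; simpl; auto with holo. Qed.

Lemma holo_at_euler_maclaurin_sum (m : nat) (z : C) : holo_at (fun s => euler_maclaurin_sum s m) z.
Proof.
  induction m as [|m IH]; [apply (holo_at_const 0)|].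
  apply (holo_at_plus (fun s => euler_maclaurin_sum s m)); [exact IH|].
  apply (holo_at_mult (fun s => rising_factorial s (S m))); [|apply holo_at_const].
  apply holo_at_rising_factorial.
Qed.

Lemma holo_at_zeta_regular_part (m : nat) (s : C) : - INR m < Re s ->
  holo_at (zeta_regular_part m) s.
Proof.
  intros Hs; apply holo_at_minus.
  - apply holo_at_plus; [apply holo_at_const|apply holo_at_euler_maclaurin_sum].
  - apply holo_at_mult; [apply holo_at_rising_factorial|].
    apply (holo_at_comp (fun z => Cseries (fun n => power_integral (bern_poly (S m)) n z)));
      [|auto with holo].
    apply holo_at_Cseries_power_integral; [apply continuous_bern_poly|].
    rewrite re_opp, re_plus, re_RtoC, S_INR; lra.
Qed.

Section Zeta.

Variable zeta : C -> C.
Hypothesis zeta_spec : riemann_zeta zeta.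

Lemma zeta_series (s : C) : 1 < Re s -> is_Cseries (fun n => cpow (INR n + 1) (- s)) (zeta s).
Proof.
  intros Hs; apply (is_series_ext (V := C_NormedModule) (fun n => cpow (INR (n + 1)) (- s))).
  - intros n; now rewrite plus_INR.
  - now apply zeta_spec.
Qed.

Lemma zeta_eq_regular_part_0 (s : C) : 1 < Re s -> zeta s = (/ (s - 1) + zeta_regular_part 0 s)%C.
Proof.
  intros Hs; assert (Hs1 : s <> 1) by (intros ->; rewrite re_RtoC in Hs; lra).
  assert (Hsum : is_Cseries (fun n => power_integral (fun _ => 1) n (- s))
    (zeta s - 1 / 2 * 1 + s * euler_maclaurin_remainder 1 s)%C).
  { apply (is_series_ext (V := C_NormedModule) (fun n => cpow (INR n + 1) (- s)
      - 1 / 2 * (cpow (INR n + 1) (- s) - cpow (INR n + 2) (- s))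
      + s * power_integral (bern_poly 1) n (- (s + INR 1)))%C).
    - intros n; rewrite (power_integral_parts (bern_poly 1) (fun _ => 1)).
      + rewrite !bern_poly_deg1; simpl INR.
        replace (- (s + 1))%C with (- s - 1)%C by ring.
        rewrite !RtoC_minus, RtoC_div by lra; eq_in_C; field.
      + intros t; pose proof (is_derive_bern_poly 0 t) as H; now rewrite bern_poly_deg0 in H.
      + intros t; apply continuous_const.
    - apply is_Cseries_plus; [apply is_Cseries_minus|]; [now apply zeta_series| |];
        apply is_Cseries_mult_l.
      + apply is_Cseries_cpow_telescope; lra.
      + apply Cseries_correct, ex_Cseries_euler_maclaurin; simpl INR; lra. }
  assert (Htel : is_Cseries (fun n => power_integral (fun _ => 1) n (- s)) (1 * / (s - 1))%C).
  { apply (is_series_ext (V := C_NormedModule) (fun n =>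
      (cpow (INR n + 1) (- (s - 1)) - cpow (INR n + 2) (- (s - 1))) * / (s - 1))%C).
    - intros n; now rewrite power_integral_1.
    - apply is_Cseries_mult_r, is_Cseries_cpow_telescope.
      unfold Cminus; rewrite re_plus, re_opp, re_RtoC; lra. }
  apply is_Cseries_unique in Hsum; apply is_Cseries_unique in Htel; rewrite Hsum in Htel.
  unfold zeta_regular_part; simpl.
  replace (/ (s - 1))%C with (1 * / (s - 1))%C by ring; rewrite <- Htel; simpl; ring.
Qed.

Lemma zeta_eq_regular_part_right (m : nat) (s : C) : 1 < Re s ->
  zeta s = (/ (s - 1) + zeta_regular_part m s)%C.
Proof.
  intros Hs; induction m as [|m IH]; [now apply zeta_eq_regular_part_0|].
  rewrite zeta_regular_part_S; [exact IH|pose proof (pos_INR m); lra].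
Qed.

Theorem zeta_eq_regular_part (m : nat) (s : C) : 0 < Cmod (s - 1) < INR m + 1 ->
  zeta s = (/ (s - 1) + zeta_regular_part m s)%C.
Proof.
  intros Hs; apply Ceq_minus.
  apply (punctured_disc_vanishing (fun s => zeta s - (/ (s - 1) + zeta_regular_part m s))%C 1
    (INR m + 1)); [| |exact Hs].
  - intros z Hz; assert (Hz1 : z <> 1).
    { intros ->; replace (RtoC 1 - 1)%C with (RtoC 0) in Hz by ring; rewrite Cmod_0 in Hz; lra. }
    apply holo_at_minus; [now apply zeta_spec|apply holo_at_plus].
    + apply (holo_at_comp Cinv); [|auto with holo].
      now apply holo_at_Cinv, Cminus_eq_contra.
    + apply holo_at_zeta_regular_part.
      pose proof (re_le_Cmod (z - 1)) as Hre; unfold Cminus in Hre at 1.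
      rewrite re_plus, re_opp, re_RtoC in Hre; apply Rabs_le_between in Hre; lra.
  - intros r Hr; apply (proj1 (Ceq_minus _ _)), zeta_eq_regular_part_right.
    rewrite re_plus, !re_RtoC; lra.
Qed.

End Zeta.

(** * Values of zeta at the negative integers *)

Lemma rising_factorial_neg (j k : nat) : (k <= j)%nat ->
  rising_factorial (- INR j) k = RtoC ((-1) ^ k * INR (fact j) / INR (fact (j - k))).
Proof.
  induction k as [|k IH]; intros Hk.
  - rewrite Nat.sub_0_r; simpl; f_equal; field; apply INR_fact_neq_0.
  - simpl rising_factorial; rewrite IH, <- RtoC_opp, <- RtoC_plus, <- RtoC_mult by lia; f_equal.
    replace (j - k)%nat with (S (j - S k)) by lia; rewrite INR_fact_S.
    replace (- INR j + INR k) with (- (INR (j - S k) + 1))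
      by (rewrite minus_INR, S_INR by lia; ring).
    pose proof (pos_INR (j - S k)); simpl pow; field; split; [apply INR_fact_neq_0|lra].
Qed.

Lemma rising_factorial_neg_eq_0 (j k : nat) : (j < k)%nat -> rising_factorial (- INR j) k = 0.
Proof.
  induction 1 as [|k Hk IH]; simpl; [|rewrite IH]; ring.
Qed.

Lemma bern_alternate (i : nat) : (-1) ^ S i * bern (S (S i)) = - bern (S (S i)).
Proof.
  destruct (Nat.Even_or_Odd i) as [[k ->]|[k ->]].
  - rewrite pow_1_odd; ring.
  - replace (S (S (2 * k + 1))) with (2 * k + 3)%nat by lia; rewrite bern_odd; ring.
Qed.

Lemma euler_maclaurin_sum_neg (j m : nat) : (m <= j)%nat ->
  euler_maclaurin_sum (- INR j) m
  = RtoC (1 / INR (S j) - 1 / 2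
          - INR (fact j) * sum_f_R0 (fun i => bern i / INR (fact (S j - i))) (S m)).
Proof.
  pose proof (INR_fact_neq_0 j) as Hfact; pose proof (pos_INR j).
  induction m as [|m IH]; intros Hm.
  - simpl euler_maclaurin_sum; f_equal; cbn [sum_f_R0].
    replace (S j - 1)%nat with j by lia.
    rewrite bern_0, bern_1, Nat.sub_0_r, INR_fact_S, S_INR; field; split; [exact Hfact|lra].
  - change (euler_maclaurin_sum (- INR j) (S m)) with
      (euler_maclaurin_sum (- INR j) m + rising_factorial (- INR j) (S m) * bern (S (S m)))%C.
    rewrite IH, rising_factorial_neg, <- RtoC_mult, <- RtoC_plus by lia; f_equal.
    rewrite (tech5 _ (S m)).
    replace ((-1) ^ S m * INR (fact j) / INR (fact (j - S m)) * bern (S (S m)))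
      with (INR (fact j) / INR (fact (j - S m)) * ((-1) ^ S m * bern (S (S m))))
      by (unfold Rdiv; ring).
    rewrite bern_alternate; simpl Nat.sub; field.
    split; [apply INR_fact_neq_0|rewrite S_INR; lra].
Qed.

Lemma zeta_neg_integer (zeta : C -> C) (j : nat) : riemann_zeta zeta ->
  zeta (RtoC (- INR j)) = RtoC (- (INR (fact j) * bern_poly (S j) 1)).
Proof.
  intros Hzeta; pose proof (pos_INR j).
  rewrite (zeta_eq_regular_part zeta Hzeta (S j)).
  2:{ rewrite <- RtoC_minus, Cmod_R, Rabs_left, S_INR by lra; lra. }
  unfold zeta_regular_part; rewrite RtoC_opp, (rising_factorial_neg_eq_0 j (S (S j))) by lia.
  change (euler_maclaurin_sum (- INR j) (S j)) with
    (euler_maclaurin_sum (- INR j) j + rising_factorial (- INR j) (S j) * bern (S (S j)))%C.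
  rewrite rising_factorial_neg_eq_0, euler_maclaurin_sum_neg by lia.
  replace (bern_poly (S j) 1) with (sum_f_R0 (fun i => bern i / INR (fact (S j - i))) (S j))
    by (apply sum_eq; intros i _; now rewrite pow1, Rmult_1_r).
  set (X := INR (fact j) * _).
  replace (/ (- INR j - 1))%C with (RtoC (- (1 / INR (S j)))).
  2:{ rewrite <- RtoC_opp, <- RtoC_minus, <- RtoC_inv, S_INR by lra; f_equal; field; lra. }
  rewrite <- RtoC_div, !RtoC_minus, !RtoC_opp by lra; ring.
Qed.

Lemma zeta_0 (zeta : C -> C) : riemann_zeta zeta -> zeta (RtoC 0) = RtoC (- (1 / 2)).
Proof.
  intros Hzeta; pose proof (zeta_neg_integer zeta 0 Hzeta) as H0; simpl INR in H0.
  rewrite Ropp_0, bern_poly_deg1 in H0; rewrite H0; f_equal; simpl; field.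
Qed.

Lemma zeta_neg_odd (zeta : C -> C) (k : nat) : riemann_zeta zeta ->
  zeta (RtoC (- INR (2 * k + 1))) = RtoC (- (INR (fact (2 * k + 1)) * bern (2 * k + 2))).
Proof.
  intros Hzeta; rewrite zeta_neg_integer, bern_poly_at_1 by (exact Hzeta || lia).
  now replace (S (2 * k + 1)) with (2 * k + 2)%nat by lia.
Qed.

(** * The double zeta function *)

Lemma Series_tail_lim (a : nat -> R) : ex_series a ->
  is_lim_seq (fun K => Series (fun j => a (S K + j)%nat)) 0.
Proof.
  intros Ha; apply (is_lim_seq_ext (fun K => Series a - sum_n a K)).
  - intros K; rewrite (Series_incr_n a (S K)) by (lia || exact Ha).
    rewrite sum_n_Reals; simpl pred; ring.
  - replace 0 with (Series a - Series a) by ring.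
    apply is_lim_seq_minus'; [apply is_lim_seq_const|exact (Series_correct a Ha)].
Qed.

Lemma is_Cseries_tail (b : nat -> C) (l : C) (m : nat) :
  is_Cseries b l -> is_Cseries (fun j => b (S m + j)%nat) (l - sum_n b m)%C.
Proof.
  intros Hb; apply (is_series_incr_n (V := C_NormedModule) b (S m)); [lia|]; evar_last; [exact Hb|].
  change (l = l - sum_n b m + sum_n b m)%C; ring.
Qed.

Lemma is_Cseries_tail_S (b T : nat -> C) (K : nat) :
  (forall m, is_Cseries (fun j => b (S m + j)%nat) (T m)) -> T K = (T (S K) + b (S K))%C.
Proof.
  intros HT; rewrite <- (is_Cseries_unique _ _ (HT K)); apply is_Cseries_unique.
  apply (is_series_decr_1 (V := C_NormedModule)).
  apply (is_series_ext (V := C_NormedModule) (fun j => b (S (S K) + j)%nat)).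
  - intros j; f_equal; lia.
  - rewrite Nat.add_0_r; change plus with Cplus; change opp with Copp.
    replace (T (S K) + b (S K) + - b (S K))%C with (T (S K)) by ring; apply HT.
Qed.

Lemma sum_n_mul_tails (a b T : nat -> C) (K : nat) :
  (forall m, is_Cseries (fun j => b (S m + j)%nat) (T m)) ->
  sum_n (fun m => a m * T m)%C K
  = (sum_n (fun k => (sum_n a k - a k) * b k)%C K + sum_n a K * T K)%C.
Proof.
  intros HT; induction K as [|K IH]; [rewrite !sum_O; eq_in_C; ring|].
  rewrite !sum_Sn, IH, (is_Cseries_tail_S b T K HT); change plus with Cplus; eq_in_C; ring.
Qed.

(* Summation by parts: the double sum over m < k of [a m * b k] is regrouped by k. *)
Lemma is_Cseries_mul_tails (a b T : nat -> C) (e : nat -> R) (l : C) :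
  (forall m, is_Cseries (fun j => b (S m + j)%nat) (T m)) ->
  is_Cseries (fun k => (sum_n a k - a k) * b k)%C l -> ex_series e ->
  (forall K j, Cmod (sum_n a K * b (S K + j)%nat) <= e (S K + j)%nat) ->
  is_Cseries (fun m => a m * T m)%C l.
Proof.
  intros HT Hv He Hbound; apply is_Cseries_iff.
  apply (is_lim_seq_le_le (fun _ => 0) _ (fun K =>
    Cmod (sum_n (fun k => (sum_n a k - a k) * b k)%C K - l) + Series (fun j => e (S K + j)%nat))).
  - intros K; split; [apply Cmod_ge_0|]; rewrite (sum_n_mul_tails a b T K HT).
    set (v := sum_n (fun k => (sum_n a k - a k) * b k)%C K).
    replace (v + sum_n a K * T K - l)%C with (v - l + sum_n a K * T K)%C by ring.
    apply Rle_trans with (1 := Cmod_triangle _ _), Rplus_le_compat_l.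
    apply Cmod_is_Cseries_le with (fun j => sum_n a K * b (S K + j)%nat)%C;
      [now apply is_Cseries_mult_l|intros j; apply Hbound|].
    now apply (ex_series_incr_n e (S K)).
  - apply is_lim_seq_const.
  - replace (Finite 0) with (Finite (0 + 0)) by (f_equal; ring).
    apply is_lim_seq_plus'; [now apply is_Cseries_iff|now apply Series_tail_lim].
Qed.

Lemma sum_n_RtoC (f : nat -> R) (n : nat) :
  sum_n (fun k => RtoC (f k)) n = RtoC (sum_f_R0 f n).
Proof.
  induction n as [|n IH]; [apply sum_O|].
  rewrite sum_Sn, IH, tech5, RtoC_plus; reflexivity.
Qed.

Lemma sum_n_Cmult_r (f : nat -> C) (c : C) (n : nat) :
  sum_n (fun k => f k * c)%C n = (sum_n f n * c)%C.
Proof. apply (sum_n_mult_r (K := C_Ring)). Qed.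

Lemma sum_n_add_one (f g : nat -> C) (L j0 : nat) (r : C) : (j0 <= L)%nat ->
  (forall j, j <> j0 -> f j = g j) -> f j0 = (g j0 + r)%C -> sum_n f L = (sum_n g L + r)%C.
Proof.
  intros Hj0 Hne Heq; induction L as [|L IH].
  - rewrite !sum_O; now replace 0%nat with j0 by lia.
  - rewrite !sum_Sn; change plus with Cplus; destruct (Nat.eq_dec j0 (S L)) as [->|Hneq].
    + rewrite Heq, (sum_n_ext_loc f g) by (intros j Hj; apply Hne; lia); eq_in_C; ring.
    + rewrite IH, (Hne (S L)) by lia; eq_in_C; ring.
Qed.

Lemma INR_pow_exp (k p : nat) : INR (k + 1) ^ p = exp (INR p * ln (INR (k + 1))).
Proof. symmetry; apply Rpower_pow, lt_0_INR; lia. Qed.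

Lemma power_sum_le (n K : nat) :
  0 <= sum_f_R0 (fun i => INR (i + 1) ^ n) K <= INR (K + 1) ^ (n + 1).
Proof.
  split.
  - apply cond_pos_sum; intros i; apply pow_le, pos_INR.
  - apply Rle_trans with (sum_f_R0 (fun _ => INR (K + 1) ^ n) K).
    + apply sum_Rle; intros i Hi; apply pow_incr; split; [apply pos_INR|apply le_INR; lia].
    + rewrite sum_cte, pow_add, pow_1, Nat.add_1_r; apply Rle_refl.
Qed.

Definition zeta_comb (zeta : C -> C) (c : nat -> R) (L : nat) (s : C) : C :=
  sum_n (fun j => c j * zeta (s + RtoC (INR j - 1)))%C L.

Section DoubleZeta.

Variable zeta : C -> C.
Hypothesis zeta_spec : riemann_zeta zeta.

Lemma is_Cseries_zeta_comb (c : nat -> R) (n L : nat) (s : C) : 2 < Re s -> (L <= n + 1)%nat ->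
  is_Cseries (fun k => sum_f_R0 (fun j => c j * INR (k + 1) ^ (n + 1 - j))%R L
    * cpow (INR (k + 1)) (- (s + INR n)))%C (zeta_comb zeta c L s).
Proof.
  intros Hs HL.
  apply (is_series_ext (V := C_NormedModule)
    (fun k => sum_n (fun j => c j * cpow (INR (k + 1)) (- (s + RtoC (INR j - 1))))%C L)).
  - intros k; rewrite <- sum_n_RtoC, <- sum_n_Cmult_r; apply sum_n_ext_loc; intros j Hj.
    rewrite RtoC_mult, INR_pow_exp, <- cpow_RtoC, <- Cmult_assoc, <- cpow_plus; do 2 f_equal.
    rewrite minus_INR, plus_INR, !RtoC_minus, RtoC_plus by lia; simpl INR; ring.
  - apply (is_Cseries_sum_n (fun j k => c j * cpow (INR (k + 1)) (- (s + RtoC (INR j - 1))))%C).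
    intros j Hj; apply is_Cseries_mult_l, zeta_spec.
    rewrite re_plus, re_RtoC; pose proof (pos_INR j); lra.
Qed.

Theorem dz_rep_zeta_comb (c : nat -> R) (n L : nat) : (L <= n + 1)%nat ->
  (forall k, sum_f_R0 (fun i => INR (i + 1) ^ n) k - INR (k + 1) ^ n
     = sum_f_R0 (fun j => c j * INR (k + 1) ^ (n + 1 - j)) L) ->
  dz_rep n (zeta_comb zeta c L).
Proof.
  intros HL Hc s Hs; pose proof (pos_INR n) as Hn.
  set (a := fun m => RtoC (INR (m + 1) ^ n)).
  set (b := fun k => cpow (INR (k + 1)) (- (s + INR n))).
  assert (Hb : is_Cseries b (zeta (s + INR n)%C))
    by (apply zeta_spec; rewrite re_plus, re_RtoC; lra).
  set (T := fun m => (zeta (s + INR n)%C - sum_n b m)%C).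
  assert (HT : forall m, is_Cseries (fun j => b (S m + j)%nat) (T m)).
  { now intros m; apply is_Cseries_tail. }
  exists (fun m => a m * T m)%C; split.
  - intros m; apply (is_series_ext (V := C_NormedModule) (fun j => a m * b (S m + j)%nat)%C);
      [|now apply is_Cseries_mult_l].
    intros j; unfold a, b, dz_term; now replace (S m + j + 1)%nat with (m + j + 2)%nat by lia.
  - apply (is_Cseries_mul_tails a b T (fun k => exp (- (1 + (Re s - 2)) * ln (INR k + 1)))).
    + exact HT.
    + apply (is_series_ext (V := C_NormedModule) (fun k =>
        sum_f_R0 (fun j => c j * INR (k + 1) ^ (n + 1 - j))%R L * b k)%C);
        [|now apply is_Cseries_zeta_comb].
      intros k; unfold a; now rewrite <- Hc, RtoC_minus, sum_n_RtoC.
    + apply ex_series_power_decay; lra.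
    + intros K j; unfold a, b; rewrite sum_n_RtoC, Cmod_mult, Cmod_R, Cmod_cpow.
      destruct (power_sum_le n K) as [Hpos Hle]; rewrite Rabs_pos_eq by exact Hpos.
      apply Rle_trans with (INR (S K + j + 1) ^ (n + 1)
        * exp (Re (- (s + INR n)) * ln (INR (S K + j + 1)))).
      * apply Rmult_le_compat_r; [left; apply exp_pos|].
        apply Rle_trans with (1 := Hle), pow_incr; split; [apply pos_INR|apply le_INR; lia].
      * rewrite INR_pow_exp, <- exp_plus, re_opp, re_plus, re_RtoC; right; f_equal.
        rewrite !plus_INR; simpl (INR 1); ring.
Qed.

Lemma holo_at_zeta_comb (c : nat -> R) (L : nat) (s : C) :
  (forall j, (j <= L)%nat -> c j <> 0 -> s <> RtoC (2 - INR j)) -> holo_at (zeta_comb zeta c L) s.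
Proof.
  intros Hs; apply (holo_at_sum_n (fun j s => c j * zeta (s + RtoC (INR j - 1)))%C); intros j Hj.
  destruct (Req_dec (c j) 0) as [Hcj|Hcj].
  - rewrite Hcj; apply holo_at_ext with (fun _ => RtoC 0); [intros y; ring|apply holo_at_const].
  - apply holo_at_mult; [apply holo_at_const|].
    apply (holo_at_comp zeta (fun s => s + RtoC (INR j - 1))%C); [|auto with holo].
    apply zeta_spec; intros Heq; apply (Hs j Hj Hcj).
    replace (2 - INR j) with (1 - (INR j - 1)) by ring; rewrite RtoC_minus, <- Heq; ring.
Qed.

Lemma zeta_comb_pole (c : nat -> R) (L j0 : nat) : (j0 <= L)%nat -> c j0 <> 0 ->
  pole_res (zeta_comb zeta c L) (RtoC (2 - INR j0)) (c j0).
Proof.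
  intros Hj0 Hc0; split; [intros Heq; apply Hc0; now apply RtoC_inj in Heq|].
  set (h := fun j => if Nat.eq_dec j j0 then zeta_regular_part 0 else zeta).
  assert (Hshift : forall j z, (z + RtoC (INR j - 1) - 1 = z - RtoC (2 - INR j))%C)
    by (intros; rewrite !RtoC_minus; ring).
  exists 1; split; [lra|]; exists (fun z => sum_n (fun j => c j * h j (z + RtoC (INR j - 1)))%C L).
  split; intros z Hz.
  - apply (holo_at_sum_n (fun j z => c j * h j (z + RtoC (INR j - 1)))%C); intros j Hj.
    apply holo_at_mult; [apply holo_at_const|].
    apply (holo_at_comp (h j) (fun z => z + RtoC (INR j - 1))%C); [|auto with holo].
    unfold h; destruct (Nat.eq_dec j j0) as [->|Hne].
    + apply holo_at_zeta_regular_part; simpl INR.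
      pose proof (re_le_Cmod (z - RtoC (2 - INR j0))) as Hre; unfold Cminus in Hre at 1.
      rewrite re_plus, re_opp, re_RtoC in Hre; apply Rabs_le_between in Hre.
      rewrite re_plus, re_RtoC; lra.
    + apply zeta_spec; intros Heq; apply (Rlt_not_le _ _ Hz).
      replace z with (1 - RtoC (INR j - 1))%C by (rewrite <- Heq; ring).
      rewrite <- !RtoC_minus, Cmod_R.
      replace (1 - (INR j - 1) - (2 - INR j0)) with (IZR (Z.of_nat j0 - Z.of_nat j))
        by (rewrite minus_IZR, <- !INR_IZR_INZ; ring).
      rewrite <- abs_IZR; apply IZR_le; lia.
  - apply sum_n_add_one with j0; [exact Hj0| |]; unfold h.
    + intros j Hj; now destruct (Nat.eq_dec j j0).
    + destruct (Nat.eq_dec j0 j0) as [_|Hneq]; [|contradiction].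
      rewrite (zeta_eq_regular_part zeta zeta_spec 0), Hshift.
      * unfold Cdiv; ring.
      * rewrite Hshift; simpl INR; lra.
Qed.

Lemma zeta_comb_pole_at_2 (c : nat -> R) (L : nat) : c 0%nat <> 0 ->
  pole_res (zeta_comb zeta c L) 2 (c 0%nat).
Proof.
  intros Hc; replace (RtoC 2) with (RtoC (2 - INR 0)) by (f_equal; simpl; ring).
  apply zeta_comb_pole; [lia|exact Hc].
Qed.

Lemma zeta_comb_pole_at_1 (c : nat -> R) (L : nat) : (1 <= L)%nat -> c 1%nat <> 0 ->
  pole_res (zeta_comb zeta c L) 1 (c 1%nat).
Proof.
  intros HL Hc; replace (RtoC 1) with (RtoC (2 - INR 1)) by (f_equal; simpl; ring).
  now apply zeta_comb_pole.
Qed.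

Lemma holo_at_zeta_comb_1 (c : nat -> R) (s : C) : s <> 2 -> s <> 1 ->
  holo_at (zeta_comb zeta c 1) s.
Proof.
  intros H2 H1; apply holo_at_zeta_comb; intros [|[|j]] Hj _; [| |lia]; simpl INR.
  - now rewrite Rminus_0_r.
  - now replace (2 - 1) with 1 by ring.
Qed.

(* For n = 0 the inner sum over m < k of 1 is k - 1. *)
Lemma dz_rep_0 : dz_rep 0 (zeta_comb zeta (pow (-1)) 1).
Proof.
  apply dz_rep_zeta_comb; [lia|]; intros k.
  cbn [pow]; rewrite sum_cte, Nat.add_1_r; simpl; ring.
Qed.

Definition dz_coef (n j : nat) : R := INR (fact n) * bern j / INR (fact (n + 1 - j)).

Lemma faulhaber (n k : nat) : (1 <= n)%nat ->
  sum_f_R0 (fun i => INR (i + 1) ^ n) k - INR (k + 1) ^ n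
  = sum_f_R0 (fun j => dz_coef n j * INR (k + 1) ^ (n + 1 - j)) n.
Proof.
  intros Hn.
  replace (sum_f_R0 (fun i => INR (i + 1) ^ n) k - INR (k + 1) ^ n)
    with (sum_f_R0 (fun m => INR m ^ n) k).
  2:{ destruct n as [|n]; [lia|]; induction k as [|k IH]; [simpl; ring|].
      rewrite !tech5, IH, !Nat.add_1_r; ring. }
  rewrite power_sum_bern_poly, bern_poly_S, <- S_INR, <- (Nat.add_1_r k).
  unfold Rminus; rewrite Rplus_assoc, Rplus_opp_r, Rplus_0_r.
  rewrite scal_sum; apply sum_eq; intros j Hj; unfold dz_coef.
  replace (n + 1 - j)%nat with (S (n - j)) by lia; unfold Rdiv; ring.
Qed.

Lemma dz_coef_0 (n : nat) : dz_coef n 0 = 1 / INR (n + 1).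
Proof.
  unfold dz_coef; rewrite bern_0, Nat.sub_0_r, Nat.add_1_r, INR_fact_S, S_INR.
  pose proof (pos_INR n); field; split; [lra|apply INR_fact_neq_0].
Qed.

Lemma dz_coef_1 (n : nat) : dz_coef n 1 = - (1 / 2).
Proof. unfold dz_coef; rewrite bern_1, Nat.add_sub; field; apply INR_fact_neq_0. Qed.

Lemma dz_coef_odd (n k : nat) : dz_coef n (2 * k + 3) = 0.
Proof. unfold dz_coef; rewrite bern_odd; unfold Rdiv; ring. Qed.

Lemma dz_coef_even_neq_0 (n k : nat) : dz_coef n (2 * k + 2) <> 0.
Proof.
  unfold dz_coef, Rdiv; repeat apply Rmult_integral_contrapositive_currified;
    [apply INR_fact_neq_0|apply bern_even_neq_0|apply Rinv_neq_0_compat, INR_fact_neq_0].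
Qed.

Lemma falling_neg (r b : nat) :
  falling (- Z.of_nat (S r)) b = (-1) ^ b * INR (fact (r + b)) / INR (fact r).
Proof.
  induction b as [|b IH].
  - rewrite Nat.add_0_r; simpl; field; apply INR_fact_neq_0.
  - cbn [falling].
    rewrite IH, opp_IZR, <- INR_IZR_INZ, Nat.add_succ_r, INR_fact_S, S_INR, plus_INR.
    simpl pow; unfold Rdiv; ring.
Qed.

Lemma dz_coef_even (n k : nat) : (2 * k + 2 <= n)%nat ->
  RtoC (dz_coef n (2 * k + 2))
  = (gbinom (Z.of_nat (2 * k) - Z.of_nat n) (2 * k + 1) * zeta (RtoC (- INR (2 * k + 1))))%C.
Proof.
  intros Hn; rewrite (zeta_neg_odd zeta k zeta_spec), <- RtoC_mult; f_equal; unfold gbinom, dz_coef.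
  replace (Z.of_nat (2 * k) - Z.of_nat n)%Z with (- Z.of_nat (S (n - 2 * k - 1)))%Z by lia.
  rewrite falling_neg; replace (n - 2 * k - 1 + (2 * k + 1))%nat with n by lia.
  replace (n + 1 - (2 * k + 2))%nat with (n - 2 * k - 1)%nat by lia.
  replace ((-1) ^ (2 * k + 1)) with (-1) by (rewrite Nat.add_1_r, pow_1_odd; reflexivity).
  field; split; apply INR_fact_neq_0.
Qed.

Lemma INR_even_pole (k : nat) : 2 - INR (2 * k + 2) = - INR (2 * k).
Proof. rewrite plus_INR; simpl (INR 2); ring. Qed.

Definition dz_continuation (n : nat) : C -> C := zeta_comb zeta (dz_coef n) n.

Lemma dz_rep_continuation (n : nat) : (1 <= n)%nat -> dz_rep n (dz_continuation n).
Proof. intros Hn; apply dz_rep_zeta_comb; [lia|intros k; now apply faulhaber]. Qed.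

Lemma holo_at_dz_continuation (n : nat) (s : C) : s <> 2 -> s <> 1 ->
  (forall k, (2 * k + 2 <= n)%nat -> s <> RtoC (- INR (2 * k))) ->
  holo_at (dz_continuation n) s.
Proof.
  intros H2 H1 Hs; apply holo_at_zeta_comb; intros [|[|j]] Hj Hcj.
  - simpl INR; now rewrite Rminus_0_r.
  - simpl INR; now replace (2 - 1) with 1 by ring.
  - destruct (Nat.Even_or_Odd j) as [[k ->]|[k ->]].
    + replace (S (S (2 * k))) with (2 * k + 2)%nat by lia; rewrite INR_even_pole; apply Hs; lia.
    + exfalso; apply Hcj; replace (S (S (2 * k + 1))) with (2 * k + 3)%nat by lia.
      apply dz_coef_odd.
Qed.

Lemma dz_continuation_pole_at_2 (n : nat) :
  pole_res (dz_continuation n) 2 (RtoC (1 / INR (n + 1))).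
Proof.
  rewrite <- dz_coef_0; apply zeta_comb_pole_at_2; rewrite dz_coef_0.
  apply Rgt_not_eq, Rdiv_lt_0_compat; [lra|apply lt_0_INR; lia].
Qed.

Lemma dz_continuation_pole_at_1 (n : nat) : (1 <= n)%nat ->
  pole_res (dz_continuation n) 1 (zeta 0).
Proof.
  intros Hn; rewrite (zeta_0 zeta zeta_spec), <- (dz_coef_1 n).
  apply zeta_comb_pole_at_1; [exact Hn|rewrite dz_coef_1; lra].
Qed.

Lemma dz_continuation_pole_at_even (n k : nat) : (2 * k + 2 <= n)%nat ->
  pole_res (dz_continuation n) (RtoC (- INR (2 * k)))
    (gbinom (Z.of_nat (2 * k) - Z.of_nat n) (2 * k + 1) * zeta (RtoC (- INR (2 * k + 1))))%C.
Proof.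
  intros Hk; rewrite <- INR_even_pole, <- dz_coef_even by exact Hk.
  apply zeta_comb_pole; [exact Hk|apply dz_coef_even_neq_0].
Qed.

End DoubleZeta.

Lemma lt_div2_iff (k n : nat) : (k < Nat.div2 n)%nat <-> (2 * k + 2 <= n)%nat.
Proof. pose proof (Nat.div2_odd n) as Hn; destruct (Nat.odd n); simpl in Hn; lia. Qed.

Theorem theorem4p1 :
  forall zeta : C -> C, riemann_zeta zeta ->
  (* n = 0 : zeta(0, s) *)
  (exists F : C -> C, dz_rep 0 F /\
     (forall s : C, s <> RtoC 2 -> s <> RtoC 1 -> holo_at F s) /\
     pole_res F (RtoC 2) (RtoC 1) /\
     pole_res F (RtoC 1) (Cmult (RtoC 2) (zeta (RtoC 0)))) /\
  (* n = 1 : zeta(-1, s+1) *)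
  (exists F : C -> C, dz_rep 1 F /\
     (forall s : C, s <> RtoC 2 -> s <> RtoC 1 -> holo_at F s) /\
     pole_res F (RtoC 2) (RtoC (1 / 2)) /\
     pole_res F (RtoC 1) (zeta (RtoC 0))) /\
  (* n >= 2 : zeta(-n, s+n) *)
  (forall n : nat, (2 <= n)%nat ->
   exists F : C -> C, dz_rep n F /\
     (forall s : C, s <> RtoC 2 -> s <> RtoC 1 ->
        (forall k : nat, (k < Nat.div2 n)%nat -> s <> RtoC (- INR (2 * k))) ->
        holo_at F s) /\
     pole_res F (RtoC 2) (RtoC (1 / INR (n + 1))) /\
     pole_res F (RtoC 1) (zeta (RtoC 0)) /\
     zeta (RtoC 0) = RtoC (- (1 / 2)) /\
     (forall k : nat, (k < Nat.div2 n)%nat ->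
        pole_res F (RtoC (- INR (2 * k)))
          (Cmult (RtoC (gbinom (Z.of_nat (2 * k) - Z.of_nat n)%Z (2 * k + 1)))
                 (zeta (RtoC (- INR (2 * k + 1))))))).
Proof.
  intros zeta Hzeta; pose proof (zeta_0 zeta Hzeta) as Hzeta0.
  split; [|split; [|intros n Hn]].
  - exists (zeta_comb zeta (pow (-1)) 1); split; [|split; [|split]].
    + now apply dz_rep_0.
    + intros s H2 H1; now apply holo_at_zeta_comb_1.
    + apply (zeta_comb_pole_at_2 zeta Hzeta); simpl; lra.
    + replace (2 * zeta 0)%C with (RtoC ((-1) ^ 1))
        by (rewrite Hzeta0, <- RtoC_mult; f_equal; field).
      apply (zeta_comb_pole_at_1 zeta Hzeta); [lia|simpl; lra].
  - exists (dz_continuation zeta 1); split; [|split; [|split]].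
    + now apply dz_rep_continuation.
    + intros s H2 H1; apply holo_at_dz_continuation; auto; lia.
    + exact (dz_continuation_pole_at_2 zeta Hzeta 1).
    + now apply dz_continuation_pole_at_1.
  - exists (dz_continuation zeta n); split; [|split; [|split; [|split; [|split]]]].
    + apply dz_rep_continuation; [exact Hzeta|lia].
    + intros s H2 H1 Hs; apply holo_at_dz_continuation; auto; intros k Hk.
      now apply Hs, lt_div2_iff.
    + now apply dz_continuation_pole_at_2.
    + apply dz_continuation_pole_at_1; [exact Hzeta|lia].
    + exact Hzeta0.
    + intros k Hk; now apply dz_continuation_pole_at_even, lt_div2_iff.
Qed.
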